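(* Let $\mathbb F$ be a field, $N\ge1$, and $M\subset\mathbb{Z}^N$ a finite set with $\mathbf 0\in M$. Let $R=\mathbb F[a_{\mathbf m}]_{\mathbf m\in M}$ be the polynomial ring in independent indeterminates $a_{\mathbf m}$, $K$ its fraction field with separable closure $\bar K$, and \[ f_M(\mathbf X)=\sum_{\mathbf m\in M}a_{\mathbf m}\mathbf X^{\mathbf m}\in R[X_1^{\pm1},\ldots,X_N^{\pm1}]. \] (a) For every torsion point $\boldsymbol\xi\in(\bar K^* )^N$, the element \[ C_{f_M}(\boldsymbol\xi)=\prod_{\tau\in\mathrm{Gal}(\mathbb F(\boldsymbol\xi^M)/\mathbb F)}\tau\bigl(f_M(\boldsymbol\xi)\bigr)\in R \] is irreducible in $R$. (b) For every finite subgroup $\Lambda\subseteq(\bar K^* )^N$, the formula \[ W_{f_M}(\Lambda)=\prod_{\substack{\text{cyclic subgroups}\\ \Lambda'\subseteq\Lambda}}\ \prod_{\substack{\boldsymbol\xi:\ \text{generators of }\Lambda'\text{ in}\\ \text{distinct }\mathrm{Gal}(\bar K/K)\text{-orbits}}} C_{f_M}(\boldsymbol\xi)^{[K(\boldsymbol\xi):K(\boldsymbol\xi^{M})]} \] is a complete factorization of $W_{f_M}(\Lambda)$ into irreducible elements of $R$.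
   Context: $\mathbf X^{\mathbf m}=X_1^{m_1}\cdots X_N^{m_N}$; $\boldsymbol\xi^M=\{\boldsymbol\xi^{\mathbf m}:\mathbf m\in M\}$ and $\mathbb F(\boldsymbol\xi^M)$, $K(\boldsymbol\xi^M)$ denote the fields generated by these elements over $\mathbb F$, resp. $K$ (note $\mathrm{Gal}(K(\boldsymbol\xi^M)/K)=\mathrm{Gal}(\mathbb F(\boldsymbol\xi^M)/\mathbb F)$). For a finite subgroup $\Lambda$, $W_{f}(\Lambda)=\prod_{\boldsymbol\zeta\in\Lambda,\,f(\boldsymbol\zeta)\ne0}f(\boldsymbol\zeta)$. In (b), one representative generator is taken from each Galois orbit of generators of each cyclic subgroup $\Lambda'$. *)

(* Defs.v *)
From HB Require Import structures.
From mathcomp Require Import all_boot all_order all_algebra.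
From mathcomp Require Import separable finmap mpoly.
From mathcomp Require Import boolp classical_sets fsbigop.

Set Implicit Arguments.
Unset Strict Implicit.
Unset Printing Implicit Defensive.

Import GRing.Theory.

Local Open Scope classical_set_scope.
Local Open Scope ring_scope.

Definition irreducible_elt (R : idomainType) (p : R) : Prop :=
  [/\ p != 0, p \isn't a GRing.unit &
      forall a b : R, p = a * b ->
        (a \is a GRing.unit) || (b \is a GRing.unit)].

Definition is_separable_closure (k L : fieldType) (iota : {rmorphism k -> L}) :
    Prop :=
  (forall x : L, exists p : {poly k},
     [/\ p \is monic, irreducible_poly p, separable_poly p
       & root (map_poly iota p) x]) /\
  (forall q : {poly L}, separable_poly q -> (1 < size q)%N ->
     exists x : L, root q x).

Section Units.
Context (L : fieldType).

Record units := Units { uval :> L; _ : uval != 0 }.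
HB.instance Definition _ := [isSub for uval].
HB.instance Definition _ := [Choice of units by <:].

Lemma uval_neq0 (x : units) : uval x != 0. Proof. exact: (valP x). Qed.

Definition units_one : units := Units (oner_neq0 L).
Definition units_mul (x y : units) : units :=
  Units (mulf_neq0 (uval_neq0 x) (uval_neq0 y)).
Definition units_inv (x : units) : units :=
  Units (invr_neq0 (uval_neq0 x)).

Fact units_mulA : associative units_mul.
Proof. by move=> x y z; apply: val_inj; rewrite /= mulrA. Qed.
Fact units_mul1 : left_id units_one units_mul.
Proof. by move=> x; apply: val_inj; rewrite /= mul1r. Qed.
Fact units_mulr1 : right_id units_one units_mul.
Proof. by move=> x; apply: val_inj; rewrite /= mulr1. Qed.
Fact units_mulV : left_inverse units_one units_inv units_mul.
Proof. by move=> x; apply: val_inj; rewrite /= mulVf ?uval_neq0. Qed.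
Fact units_mulrV : right_inverse units_one units_inv units_mul.
Proof. by move=> x; apply: val_inj; rewrite /= mulfV ?uval_neq0. Qed.

HB.instance Definition _ := isGroup.Build units
  units_mulA units_mul1 units_mulr1 units_mulV units_mulrV.
End Units.

(* The group law is the pointwise one of finite functions into a group. *)
Notation torus N L := {ffun 'I_N -> units L}.

Definition torsion (G : groupType) (x : G) : Prop :=
  exists2 n : nat, (0 < n)%N & (x ^+ n = 1)%g.

Definition finite_subgroup (G : groupType) (H : {fset G}) : Prop :=
  group_closed (fun x : G => x \in H).

(* [H] is the set of all integer powers of [g]. *)
Definition generates (G : groupType) (g : G) (H : {fset G}) : Prop :=
  forall h : G, h \in H <-> exists n : nat, (h = g ^+ n \/ h = g ^- n)%g.

Definition cyclic_subgroup (G : groupType) (H : {fset G}) : Prop :=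
  exists g : G, generates g H.

(* [R[X_1^{+-1}, ..., X_N^{+-1}]], as finitely supported families of
   coefficients indexed by the exponents in [Z^N]. *)
Notation laurent N R := {fsfun 'rV[int]_N -> R with 0}.

Definition tmonom (N : nat) (L : fieldType) (x : torus N L) (m : 'rV[int]_N) :
  L := \prod_(i < N) uval (x i) ^ m 0 i.

Definition laurent_eval (N : nat) (R : nzRingType) (L : fieldType)
    (phi : R -> L) (f : laurent N R) (x : torus N L) : L :=
  \sum_(m <- finsupp f) phi (f m) * tmonom x m.

Definition laurent_W (N : nat) (R : nzRingType) (L : fieldType)
    (phi : R -> L) (f : laurent N R) (H : {fset torus N L}) : L :=
  \prod_(z <- H | laurent_eval phi f z != 0) laurent_eval phi f z.

Section Adjoin.
Context (k L : fieldType) (iota : {rmorphism k -> L}) (A : set L).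

(* [k(A)] *)
Definition adjoin : {pred L} := fun x =>
  `[< forall P : {pred L}, divring_closed P ->
        (forall a : k, iota a \in P) -> (forall a, A a -> a \in P) ->
        x \in P >].

Lemma adjoin_gen (a : L) : A a -> a \in adjoin.
Proof. by move=> Aa; apply/asboolP=> P _ _; apply. Qed.

Fact adjoin_divring_closed : divring_closed adjoin.
Proof.
split=> [|x y /asboolP xk /asboolP yk|x y /asboolP xk /asboolP yk];
  apply/asboolP => P Pdiv Pk PA; case: (Pdiv) => P1 PB PV //.
- by apply: PB; [apply: xk | apply: yk].
- by apply: PV; [apply: xk | apply: yk].
Qed.

HB.instance Definition _ :=
  GRing.isDivringClosed.Build L adjoin adjoin_divring_closed.

Record adjoin_field :=
  AdjoinField { adjoin_val :> L; _ : adjoin_val \in adjoin }.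
HB.instance Definition _ := [isSub for adjoin_val].
HB.instance Definition _ := [Choice of adjoin_field by <:].
HB.instance Definition _ := [SubChoice_isSubIntegralDomain of adjoin_field by <:].
HB.instance Definition _ :=
  [SubIntegralDomain_isSubField of adjoin_field by <:].

(* [Gal(k(A)/k)] *)
Definition galois_group : set (adjoin_field -> adjoin_field) :=
  [set tau : adjoin_field -> adjoin_field |
     exists g : {rmorphism adjoin_field -> adjoin_field},
     [/\ tau =1 g, bijective g &
         forall (x : adjoin_field) (a : k), val x = iota a -> g x = x]].
End Adjoin.
Arguments galois_group {k L} iota A _ : rename.

(* [b] is a basis of [E] as a vector space over [E0]. *)
Definition is_field_basis (L : fieldType) (E0 E : {pred L}) (n : nat)
    (b : 'I_n -> L) : Prop :=
  (forall i, b i \in E) /\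
  (forall x, x \in E -> exists! c : {ffun 'I_n -> L},
     (forall i, c i \in E0) /\ x = \sum_i c i * b i).

(* [[E : E0]], with value [0] if [E] is not a finite extension of [E0]. *)
Definition field_degree (L : fieldType) (E0 E : {pred L}) : nat :=
  xget 0%N [set n | exists b : 'I_n -> L, is_field_basis E0 E b].

Definition galois_conjugate (k L : fieldType) (iota : {rmorphism k -> L})
    (N : nat) (x y : torus N L) : Prop :=
  exists sigma : {rmorphism L -> L},
    [/\ bijective sigma, forall a : k, sigma (iota a) = iota a
      & forall i, uval (y i) = sigma (uval (x i))].

Section Generic.
Context (F : fieldType) (N : nat) (M : {fset 'rV[int]_N}).

Definition coef_ring : idomainType := {mpoly F[#|{: M}|]}.

Definition indet (m : M) : coef_ring := 'X_(enum_rank m).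

Definition generic_laurent : laurent N coef_ring :=
  [fsfun m : M => indet m].

Lemma finsupp_generic : finsupp generic_laurent = M.
Proof.
apply/fsetP => m; rewrite mem_finsupp /generic_laurent.
case: (boolP (m \in M)) => [mM|mM]; last by rewrite fsfun_ffun insubN ?eqxx.
rewrite fsfun_ffun insubT /= /indet.
apply/eqP => /(congr1 (mcoeff U_(enum_rank [` mM]%fset))).
by rewrite mcoeffX eqxx mcoeff0 => /eqP; rewrite oner_eq0.
Qed.

Context (Kbar : fieldType) (iota : {rmorphism {fraction coef_ring} -> Kbar}).

Definition coef_embed (p : coef_ring) : Kbar := iota (tofrac p).

Definition base_embed : {rmorphism F -> Kbar} :=
  iota \o (@tofrac coef_ring \o @mpolyC #|{: M}| F).

Definition irreducible_in_coef_ring (z : Kbar) : Prop :=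
  exists2 p : coef_ring, coef_embed p = z & irreducible_elt p.

Section Point.
Context (xi : torus N Kbar).

Definition point_set : set Kbar := [set uval (xi i) | i in [set: 'I_N]].
Definition monom_set : set Kbar := [set tmonom xi m | m in [set` M]].

(* [F(xi^M)] *)
Definition FxiM : fieldType := adjoin_field base_embed monom_set.

Fact monom_set_adjoin (m : M) : tmonom xi (val m) \in adjoin base_embed monom_set.
Proof. by apply: adjoin_gen; exists (val m) => //=; exact: valP. Qed.

Definition xi_pow (m : M) : FxiM := AdjoinField (monom_set_adjoin m).

Lemma generic_value :
  laurent_eval coef_embed generic_laurent xi =
  \sum_(m : M) coef_embed (indet m) * tmonom xi (val m).
Proof.
rewrite /laurent_eval finsupp_generic big_seq_fsetE /=.
by apply: eq_bigr => m _; rewrite fsfun_ffun valK.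
Qed.

(* The conjugate [tau (f_M(xi))] of [f_M(xi)], an element of [F(xi^M)[a_m]],
   where [tau] in [Gal(F(xi^M)/F)] acts on coefficients, i.e. fixes the
   indeterminates [a_m]; see [conj_valueE] for the comparison with the
   action of K-automorphisms of [Kbar]. *)
Definition conj_value (tau : FxiM -> FxiM) : Kbar :=
  \sum_(m : M) coef_embed (indet m) * val (tau (xi_pow m)).

Lemma conj_valueE (tau : FxiM -> FxiM)
    (sigma : {rmorphism Kbar -> Kbar}) :
    (forall a, sigma (iota a) = iota a) ->
    (forall x : FxiM, sigma (val x) = val (tau x)) ->
  sigma (laurent_eval coef_embed generic_laurent xi) =
    conj_value tau.
Proof.
move=> sK stau; rewrite generic_value rmorph_sum /=.
by apply: eq_bigr => m _; rewrite rmorphM /= /coef_embed sK -stau.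
Qed.

Definition C_generic : Kbar :=
  \big[*%R/1]_(tau \in galois_group base_embed monom_set) conj_value tau.

Definition C_exponent : nat :=
  field_degree (adjoin iota monom_set) (adjoin iota point_set).

End Point.

(* [reps] selects, in every cyclic subgroup of [H], one generator from each
   Galois orbit of generators. *)
Definition generator_reps (H : {fset torus N Kbar})
    (reps : {fset torus N Kbar} -> {fset torus N Kbar}) : Prop :=
  forall H' : {fset torus N Kbar},
    (H' `<=` H)%fset -> cyclic_subgroup H' ->
    (forall x, x \in reps H' -> generates x H') /\
    (forall y, generates y H' ->
       exists! x, x \in reps H' /\ galois_conjugate iota y x).

End Generic.

(* Main.v *)
(* Write v(z) for the vector (z^m)_m in M of a torsion point z and l_v for the
   linear form sum_m v_m X_m in fresh variables; note v_0 = 1.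

   (a) The automorphisms of Kbar over K permute the vectors v(z), z conjugate
   to xi, so the product P of the l_v over this orbit has coefficients in K.
   They are also algebraic over F, and F is algebraically closed in K, so P has
   coefficients in F. An irreducible factor of P over F vanishes modulo one
   l_v, hence modulo all of them by transitivity; the l_v are pairwise
   non-associate primes, so the factor is P. An F-automorphism tau of F(xi^M)
   preserves the fact that P vanishes modulo l_{v(xi)}, so tau(v(xi)) lies in
   the orbit: this identifies Gal(F(xi^M)/F) with the orbit of v(xi), and
   C(xi) with the value of P at X_m = a_m.

   (b) The factors of W indexed by the conjugates z of xi multiply to a power of
   C(xi) whose exponent is the common size of the fibres of z |-> v(z). The
   coordinates of xi generate a cyclic group; a generator t of it is a primitive
   element of K(xi) over K(xi^M), and the fibre is in bijection with the
   conjugates of t over K(xi^M). *)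
Require Import Defs.
From HB Require Import structures.
From mathcomp Require Import all_boot all_order all_algebra.
From mathcomp Require Import separable cyclotomic finmap mpoly.
From mathcomp Require Import cyclic generic_quotient.
From mathcomp Require Import boolp classical_sets functions fsbigop.

Set Implicit Arguments.
Unset Strict Implicit.
Unset Printing Implicit Defensive.

Import GRing.Theory.

Local Open Scope ring_scope.

(** * Subfields and minimal polynomials *)

Section AdjoinTheory.
Context (k L : fieldType) (iota : {rmorphism k -> L}) (A : set L).

Lemma adjoin_min (P : {pred L}) : divring_closed P ->
  (forall a, iota a \in P) -> (forall a, A a -> a \in P) ->
  {subset adjoin iota A <= P}.
Proof. by move=> Pdiv Pk PA x /asboolP; apply. Qed.

Lemma adjoin_base a : iota a \in adjoin iota A.
Proof. by apply/asboolP => P _ Pk _; apply: Pk. Qed.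

Definition to_adjoin a : adjoin_field iota A := AdjoinField (adjoin_base a).

Fact to_adjoin_is_zmod_morphism : zmod_morphism to_adjoin.
Proof. by move=> x y; apply: val_inj; rewrite /= rmorphB. Qed.

Fact to_adjoin_is_monoid_morphism : monoid_morphism to_adjoin.
Proof.
by split=> [|x y]; apply: val_inj; rewrite /= ?rmorph1 ?rmorphM.
Qed.

HB.instance Definition _ :=
  GRing.isZmodMorphism.Build k (adjoin_field iota A) to_adjoin
    to_adjoin_is_zmod_morphism.
HB.instance Definition _ :=
  GRing.isMonoidMorphism.Build k (adjoin_field iota A) to_adjoin
    to_adjoin_is_monoid_morphism.

Definition adjoin_incl (x : adjoin_field iota A) : L := val x.

Fact adjoin_incl_is_zmod_morphism : zmod_morphism adjoin_incl.
Proof. by []. Qed.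

Fact adjoin_incl_is_monoid_morphism : monoid_morphism adjoin_incl.
Proof. by []. Qed.

HB.instance Definition _ :=
  GRing.isZmodMorphism.Build (adjoin_field iota A) L adjoin_incl
    adjoin_incl_is_zmod_morphism.
HB.instance Definition _ :=
  GRing.isMonoidMorphism.Build (adjoin_field iota A) L adjoin_incl
    adjoin_incl_is_monoid_morphism.

(** Two morphisms agree on a subfield. [adjoin_min] speaks of subfields of [L], so this equalizer is
    described by the elements of [L] that lift to a point of agreement. *)
Lemma adjoin_rmorph_ext (L' : fieldType)
    (f g : {rmorphism adjoin_field iota A -> L'}) :
    (forall a, f (to_adjoin a) = g (to_adjoin a)) ->
    (forall x, A (val x) -> f x = g x) ->
  f =1 g.
Proof.
move=> fgk fgA; pose P : {pred L} := fun x =>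
  `[< exists2 y : adjoin_field iota A, val y = x & f y = g y >].
have Pdiv : divring_closed P.
  split=> [|_ _ /asboolP[x <- fx] /asboolP[y <- fy]
           |_ _ /asboolP[x <- fx] /asboolP[y <- fy]]; apply/asboolP.
  - by exists 1; rewrite ?rmorph1.
  - by exists (x - y); rewrite // !rmorphB fx fy.
  - by exists (x / y); rewrite // !fmorph_div fx fy.
move=> x; have /asboolP[y /val_inj-> //] : val x \in P.
apply: (adjoin_min Pdiv) (valP x) => [a|a Aa]; apply/asboolP.
  by exists (to_adjoin a).
by exists (AdjoinField (adjoin_gen iota Aa)) => //; apply: fgA.
Qed.

Lemma rmorph_adjoin_ext (L' : fieldType) (f g : {rmorphism L -> L'}) :
    (forall a, f (iota a) = g (iota a)) -> (forall x, A x -> f x = g x) ->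
  {in adjoin iota A, f =1 g}.
Proof.
move=> fgk fgA x Ax.
pose u : {rmorphism adjoin_field iota A -> L'} := f \o adjoin_incl.
pose v : {rmorphism adjoin_field iota A -> L'} := g \o adjoin_incl.
have fgA' y : A (val y) -> u y = v y by exact: fgA.
exact: (adjoin_rmorph_ext (f := u) (g := v) fgk fgA' (AdjoinField Ax)).
Qed.

(** The elements that [s] sends into [k(A)] form a subfield, so stability need only be checked on
    generators. *)
Lemma adjoin_restrict (s : {rmorphism L -> L}) :
    (forall a, s (iota a) = iota a) ->
    (forall x, A x -> s x \in adjoin iota A) ->
  exists g : {rmorphism adjoin_field iota A -> adjoin_field iota A},
    forall x, val (g x) = s (val x).
Proof.
move=> sk sA; pose P : {pred L} := fun x => s x \in adjoin iota A.
have Pdiv : divring_closed P.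
  by split=> [|x y xP yP|x y xP yP]; rewrite unfold_in ?rmorph1 ?rpred1 //
    ?rmorphB ?fmorph_div ?rpredB ?rpred_div.
have sP (x : adjoin_field iota A) : s (val x) \in adjoin iota A.
  apply: (adjoin_min Pdiv) (valP x) => // a.
  by rewrite unfold_in sk adjoin_base.
pose g x : adjoin_field iota A := AdjoinField (sP x).
have g_add : zmod_morphism g by move=> x y; apply: val_inj; rewrite /= rmorphB.
have g_mul : monoid_morphism g.
  by split=> [|x y]; apply: val_inj; rewrite /= ?rmorph1 ?rmorphM.
pose gA := GRing.isZmodMorphism.Build _ _ g g_add.
pose gM := GRing.isMonoidMorphism.Build _ _ g g_mul.
by exists (HB.pack g gA gM : {rmorphism _ -> _}).
Qed.

End AdjoinTheory.

Section SeparableClosure.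

(** By irreducibility [gcdp p q] is a nonzero constant or associate to [p]; a common root excludes
    the constant. *)
Lemma irreducible_root_dvdp (k L : fieldType) (iota : {rmorphism k -> L})
    (p q : {poly k}) (x : L) :
  irreducible_poly p -> root (map_poly iota p) x ->
  root (map_poly iota q) x = (p %| q).
Proof.
move=> [p1 pirr] px; apply/idP/idP => [qx|/dvdpP[r ->]]; last first.
  by rewrite rmorphM /= rootM px orbT.
have [/eqP /size_poly1P[c c0 gc]|/pirr/(_ (dvdp_gcdl _ _))] :=
  eqVneq (size (gcdp p q)) 1%N.
  have : root (map_poly iota (gcdp p q)) x.
    by rewrite gcdp_map root_gcd px.
  by rewrite gc map_polyC rootC fmorph_eq0 (negPf c0).
by move=> /eqp_dvdl <-; rewrite dvdp_gcdr.
Qed.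

Lemma algebraic_minpoly (k L : fieldType) (iota : {rmorphism k -> L}) (x : L) :
    algebraicOver iota x ->
  exists p, [/\ p \is monic, irreducible_poly p & root (map_poly iota p) x].
Proof.
case=> p0 p0_neq0 p0x; pose P n := `[< exists p : {poly k},
  [/\ size p = n, p != 0 & root (map_poly iota p) x] >].
have exP : exists n, P n by exists (size p0); apply/asboolP; exists p0.
case: (ex_minnP exP) => n /asboolP[p [<- p_neq0 px]] minp {n exP}.
have {}minp q : q != 0 -> root (map_poly iota q) x -> (size p <= size q)%N.
  by move=> q0 qx; apply: minp; apply/asboolP; exists q.
exists ((lead_coef p)^-1 *: p); split.
- by rewrite monicE lead_coefZ mulVf ?lead_coef_eq0.
- have lp0 : (lead_coef p)^-1 != 0 by rewrite invr_eq0 lead_coef_eq0.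
  split=> [|q q1]; first rewrite size_scale // ltnNge.
    apply: contraL px => p_le1; have := p_neq0.
    by rewrite (size1_polyC p_le1) map_polyC rootC polyC_eq0 fmorph_eq0.
  rewrite dvdpZr // => /[dup] qp /dvdpP[r rq].
  rewrite eqp_sym (eqp_trans (eqp_scale _ lp0)) // eqp_sym -dvdp_size_eqp //.
  have : r * q != 0 by rewrite -rq.
  rewrite mulf_eq0 negb_or => /andP[r0 q0].
  (* One factor vanishes at [x]. If it is [r], minimality of [p] forces [q] to be constant, against
     [q1]; if it is [q], the sizes of [p] and [q] agree. *)
  move: px; rewrite {1}rq rmorphM /= rootM => /orP[rx|qx].
    have := minp r r0 rx; rewrite rq size_mul //.
    move: q1; rewrite -size_poly_gt0 in q0.
    by case: (size q) q0 => // -[|m] // _ _; rewrite !addnS /= ltnNge leq_addr.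
  by rewrite eqn_leq minp // dvdp_leq.
by rewrite linearZ /= rootZ // fmorph_eq0 invr_eq0 lead_coef_eq0.
Qed.

(** The minimal polynomial over [k'] divides the one over [k], hence inherits separability. *)
Lemma sep_closure_tower (k k' L : fieldType) (i : {rmorphism k -> k'})
    (j : {rmorphism k' -> L}) (iota : {rmorphism k -> L}) :
  j \o i =1 iota -> is_separable_closure iota -> is_separable_closure j.
Proof.
move=> ji [alg clos]; split=> // x; have [p [pmon _ psep px]] := alg x.
have ipx : root (map_poly j (map_poly i p)) x.
  by rewrite -map_poly_comp (eq_map_poly ji).
have [|q [qmon qirr qx]] := @algebraic_minpoly _ _ j x.
  by exists (map_poly i p) => //; rewrite map_poly_eq0 monic_neq0.
exists q; split=> //; move: ipx; rewrite (irreducible_root_dvdp _ qirr qx).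
by move=> /dvdp_separable; apply; rewrite separable_map.
Qed.

Lemma sep_closure_split (k L : fieldType) (iota : {rmorphism k -> L})
    (q : {poly L}) :
    is_separable_closure iota -> separable_poly q ->
  exists2 rs : seq L, uniq rs & q %= \prod_(z <- rs) ('X - z%:P).
Proof.
case=> _ clos; elim: {q}(size q) {-2}q (leqnn (size q)) => [|n IHn] q qn qsep.
  have := separable_poly_neq0 qsep.
  by move: qn; rewrite leqn0 size_poly_eq0 => ->.
have [q1|q1] := ltnP 1 (size q); last first.
  exists [::] => //; rewrite big_nil -size_poly_eq1 eqn_leq q1.
  by rewrite size_poly_gt0 separable_poly_neq0.
have [x /factor_theorem[r rq]] := clos q qsep q1.
have q0 := separable_poly_neq0 qsep.
have r0 : r != 0 by apply: contraNneq q0 => r0; rewrite rq r0 mul0r.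
have rsep : separable_poly r by apply: dvdp_separable qsep; rewrite rq dvdp_mulr.
case: (IHn r) => // [|rs rs_uniq r_eqp].
  by move: qn; rewrite rq size_mul ?polyXsubC_eq0 // size_XsubC addn2.
have qeq : q %= \prod_(z <- x :: rs) ('X - z%:P).
  by rewrite big_cons rq mulrC; apply: eqp_mull.
by exists (x :: rs); rewrite // -separable_prod_XsubC -(eqp_separable qeq).
Qed.

End SeparableClosure.

(** * Extension of isomorphisms to separable closures *)

Section FieldGraph.
Context (k L1 L2 : fieldType).

(* [G] is the graph of an isomorphism over [k] from a subfield of [L1] to a
   subfield of [L2]. *)
Definition field_graph (u : k -> L1) (v : k -> L2) (G : set (L1 * L2)) : Prop :=
  [/\ forall c, G (u c, v c),
      forall x y x' y', G (x, y) -> G (x', y') -> G (x - x', y - y'),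
      forall x y x' y', G (x, y) -> G (x', y') -> G (x / x', y / y')
    & forall x y, G (x, y) -> (x == 0) = (y == 0)].

Lemma field_graph_inj u v G x y y' :
  field_graph u v G -> G (x, y) -> G (x, y') -> y = y'.
Proof.
move=> [_ GB _ G0] Gxy Gxy'; apply/eqP; rewrite -subr_eq0.
by rewrite -(G0 _ _ (GB _ _ _ _ Gxy Gxy')) subrr.
Qed.

(** Turns the relation into a field [g], the domain of the isomorphism, with two embeddings, so that
    polynomials over the domain become available. *)
Lemma field_graphP (u : {rmorphism k -> L1}) (v : {rmorphism k -> L2}) G :
    field_graph u v G ->
  exists (g : fieldType) (h : {rmorphism k -> g}) (a : {rmorphism g -> L1})
    (b : {rmorphism g -> L2}), [/\ a \o h =1 u, b \o h =1 v
     & forall x y, G (x, y) <-> exists c, x = a c /\ y = b c].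
Proof.
move=> hG; have [Gk GB Gdiv G0] := hG.
pose A := [set x | exists y, G (x, y)]%classic.
pose P : {pred L1} := fun x => `[< A x >].
have Pdiv : divring_closed P.
  split=> [|x x' /asboolP[y Gy] /asboolP[y' Gy']
           |x x' /asboolP[y Gy] /asboolP[y' Gy']]; apply/asboolP.
  - by exists 1; have := Gk 1; rewrite !rmorph1.
  - by exists (y - y'); apply: GB.
  - by exists (y / y'); apply: Gdiv.
have domG (c : adjoin_field u A) : exists y, G (val c, y).
  apply/asboolP; apply: (adjoin_min Pdiv) (valP c) => [a|a Aa]; apply/asboolP => //.
  by exists (v a); apply: Gk.
pose b c := projT1 (cid (domG c)).
have Gb c : G (val c, b c) := projT2 (cid (domG c)).
have bE c y : G (val c, y) -> b c = y by apply: field_graph_inj (Gb c).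
have b_add : zmod_morphism b by move=> c d; apply: bE; apply: GB; apply: Gb.
have b_unit c : (b c == 0) = (c == 0) by rewrite -(G0 _ _ (Gb c)).
have b1 : b 1 = 1 by apply: bE; have := Gk 1; rewrite !(rmorph1 u, rmorph1 v).
have b_div c d : b (c / d) = b c / b d.
  by apply: bE; rewrite fmorph_div; apply: Gdiv; apply: Gb.
have b_mul : monoid_morphism b.
  split=> // c d; rewrite -{1}[d]invrK b_div -[d^-1]mul1r b_div b1 mul1r.
  by rewrite invrK.
pose bA := GRing.isZmodMorphism.Build _ _ b b_add.
pose bM := GRing.isMonoidMorphism.Build _ _ b b_mul.
pose bR : {rmorphism adjoin_field u A -> L2} := HB.pack b bA bM.
exists (adjoin_field u A : fieldType), (@to_adjoin _ _ u A : {rmorphism _ -> _}),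
  (@adjoin_incl _ _ u A : {rmorphism _ -> _}), bR.
split=> // [c|x y]; first by apply: bE; apply: (Gk c).
split=> [Gxy|[c [-> ->]]]; last exact: Gb.
have Ax : A x by exists y.
by exists (AdjoinField (adjoin_gen u Ax)); split=> //; apply/esym/bE.
Qed.

(** The relation pairing [q(x)] with [q(y)] is the isomorphism of [g(x)] onto [g(y)] sending [x] to
    [y]: both values vanish exactly when [p] divides [q]. *)
Lemma field_graph_adjoin (g : fieldType) (h : {rmorphism k -> g})
    (a : {rmorphism g -> L1}) (b : {rmorphism g -> L2}) (p : {poly g}) x y :
    irreducible_poly p -> root (map_poly a p) x -> root (map_poly b p) y ->
  field_graph (a \o h) (b \o h)
    [set w | exists q, w = ((map_poly a q).[x], (map_poly b q).[y])]%classic.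
Proof.
move=> pirr px py; split.
- by move=> c; exists (h c)%:P; rewrite !map_polyC !hornerC.
- move=> _ _ _ _ [q [-> ->]] [r [-> ->]]; exists (q - r).
  by rewrite !rmorphB !hornerD !hornerN.
- move=> _ _ _ _ [q [-> ->]] [r [-> ->]].
  (* If [p] divides [r], both denominators are 0, and both quotients are 0 because the inverse of 0
     is 0. *)
  have [pr|/negP pr] := boolP (p %| r).
    move: (pr); rewrite -(irreducible_root_dvdp _ pirr px) => /eqP ->.
    move: (pr); rewrite -(irreducible_root_dvdp _ pirr py) => /eqP ->.
    by exists 0; rewrite !rmorph0 !horner0 !invr0 !mulr0.
  have /Bezout_eq1_coprimepP[[s t] /= st] : coprimep p r.
    apply: contra_notT pr => /(pirr.2 _)/(_ (dvdp_gcdl _ _))/eqp_dvdl <-.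
    exact: dvdp_gcdr.
  (* The Bezout coefficient [t] of [r] gives the inverse of [r(z)] at every root [z] of [p], so the
     same polynomial serves for [x] and [y]. *)
  have inv (M : fieldType) (f : {rmorphism g -> M}) z :
      root (map_poly f p) z -> (map_poly f r).[z]^-1 = (map_poly f t).[z].
    move=> /eqP pz; have := congr1 (fun q => (map_poly f q).[z]) st.
    rewrite rmorphD !rmorphM /= rmorph1 !hornerE pz mulr0 add0r => tr1.
    have r0 : (map_poly f r).[z] != 0.
      by apply/eqP => r0; move/eqP: tr1; rewrite r0 mulr0 eq_sym oner_eq0.
    by apply: (mulIf r0); rewrite mulVf.
  by exists (q * t); rewrite !rmorphM /= !hornerM !inv.
- move=> _ _ [q [-> ->]]; rewrite -!rootE.
  by rewrite (irreducible_root_dvdp _ pirr px) (irreducible_root_dvdp _ pirr py).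
Qed.

End FieldGraph.

Section SeparableClosureUnique.
Context (k L1 L2 : fieldType).
Context (u : {rmorphism k -> L1}) (v : {rmorphism k -> L2}).

(** The minimal polynomial of [x] over the domain is separable, so its transport to [L2] has a root,
    to which [x] can be sent. *)
Lemma field_graph_extend G x :
    is_separable_closure u -> is_separable_closure v -> field_graph u v G ->
  exists2 G' : set (L1 * L2), field_graph u v G' /\ (G `<=` G')%classic
    & exists y, G' (x, y).
Proof.
move=> hu hv hG; have [g [h [a [b [ah bh GE]]]]] := field_graphP hG.
have [alg _] := sep_closure_tower ah hu; have [p [pmon pirr psep px]] := alg x.
have [|y py] := hv.2 (map_poly b p) (etrans (separable_map _ _) psep).
  by rewrite size_map_poly; case: pirr.
have uE : u = a \o h :> (k -> L1) by apply/funext => c; rewrite -ah.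
have vE : v = b \o h :> (k -> L2) by apply/funext => c; rewrite -bh.
exists [set w | exists q, w = ((map_poly a q).[x], (map_poly b q).[y])]%classic.
  split; first by rewrite uE vE; exact: field_graph_adjoin pirr px py.
  move=> [x' y'] /GE[c [-> ->]]; exists c%:P.
  by rewrite !map_polyC !hornerC.
by exists y, 'X; rewrite !map_polyX !hornerX.
Qed.

Lemma field_graph_max G :
    field_graph u v G -> exists2 G' : set (L1 * L2),
      field_graph u v G' /\ (G `<=` G')%classic
    & forall H, field_graph u v H -> (G' `<=` H)%classic -> (H `<=` G')%classic.
Proof.
(* Adding [G] to every member lets the empty chain, whose union is empty, satisfy the property
   too. *)
move=> hG; pose P A := field_graph u v (A `|` G)%classic.
have [F FP Ftot|A [PA Amax]] := @Zorn_bigcup _ P; last first.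
  exists (A `|` G)%classic => [|H hH AGH]; first by split=> //; apply: subsetUr.
  apply: contrapT => HA; apply: (Amax H); last first.
    by rewrite /P setUidl // => w Gw; apply: AGH; right.
  split=> [w Aw|HA']; first by apply: AGH; left.
  by apply: HA => w /HA' Aw; left.
pose U := (\bigcup_(X in F) X `|` G)%classic; rewrite -/U.
(* Since the chain is totally ordered, any two points of the union lie in a single graph contained
   in it. *)
have hdir w w' : U w -> U w' ->
    exists Z, [/\ field_graph u v Z, Z w, Z w' & (Z `<=` U)%classic].
  have hX X : F X -> (X `|` G `<=` U)%classic.
    by move=> FX z [Xz|Gz]; [left; exists X | right].
  move=> [[X FX Xw]|Gw] [[Y FY Yw]|Gw'].
  - have [XY|YX] := Ftot X Y FX FY.
      exists (Y `|` G)%classic; split; [exact: FP|by left; apply: XY|by left|exact: hX].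
    exists (X `|` G)%classic; split; [exact: FP|by left|by left; apply: YX|exact: hX].
  - by exists (X `|` G)%classic; split; [exact: FP|left|right|exact: hX].
  - by exists (Y `|` G)%classic; split; [exact: FP|right|left|exact: hX].
  - by exists G; split=> // z Gz; right.
split.
- by case: hG => Gk _ _ _ c; right.
- move=> x y x' y' Uw Uw'; have [Z [[_ ZB _ _] Zw Zw' ZU]] := hdir _ _ Uw Uw'.
  by apply: ZU; apply: ZB.
- move=> x y x' y' Uw Uw'; have [Z [[_ _ Zd _] Zw Zw' ZU]] := hdir _ _ Uw Uw'.
  by apply: ZU; apply: Zd.
- move=> x y Uw; have [Z [[_ _ _ Z0] Zw _ _]] := hdir _ _ Uw Uw.
  exact: Z0.
Qed.

End SeparableClosureUnique.

Lemma field_graph_sym (k L1 L2 : fieldType) (u : k -> L1) (v : k -> L2) G :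
  field_graph u v G -> field_graph v u [set w | G (w.2, w.1)]%classic.
Proof.
move=> [Gk GB Gd G0]; split=> //= [x y x' y'|x y x' y'|x y].
- exact: GB.
- exact: Gd.
- by move/G0.
Qed.

(** A maximal graph is defined on all of [L1] by the extension step, and covers [L2] by the same
    step for the reversed graph. Both of its embeddings are then bijective, and [s] is one composed
    with the inverse of the other. *)
Lemma sep_closure_iso (k L1 L2 : fieldType) (u : {rmorphism k -> L1})
    (v : {rmorphism k -> L2}) G :
    is_separable_closure u -> is_separable_closure v -> field_graph u v G ->
  exists2 s : {rmorphism L1 -> L2}, bijective s & forall x y, G (x, y) -> s x = y.
Proof.
move=> hu hv hG; have [G' [hG' GG'] G'max] := field_graph_max hG.
have dom x : exists y, G' (x, y).
  have [H [hH G'H] [y Hy]] := field_graph_extend x hu hv hG'.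
  by exists y; apply: G'max Hy.
have ran y : exists x, G' (x, y).
  have [H [hH G'H] [x Hx]] := field_graph_extend y hv hu (field_graph_sym hG').
  exists x; have /= := G'max _ (field_graph_sym hH); apply=> // w G'w.
  by apply: (G'H (w.2, w.1)); rewrite /= -surjective_pairing.
have [g [h [a [b [ah bh G'E]]]]] := field_graphP hG'.
have a_surj x : exists c, a c = x.
  by have [y /G'E[c [-> _]]] := dom x; exists c.
have b_surj y : exists c, b c = y.
  by have [x /G'E[c [_ ->]]] := ran y; exists c.
pose ai x := projT1 (cid (a_surj x)); pose bi y := projT1 (cid (b_surj y)).
have aiK : cancel ai a by move=> x; apply: (projT2 (cid (a_surj x))).
have biK : cancel bi b by move=> x; apply: (projT2 (cid (b_surj x))).
have aK : cancel a ai by move=> c; apply: (fmorph_inj a); rewrite aiK.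
have bK : cancel b bi by move=> c; apply: (fmorph_inj b); rewrite biK.
pose s x := b (ai x).
have s_add : zmod_morphism s.
  by move=> x y; rewrite /s -rmorphB; congr (b _); apply: (fmorph_inj a);
    rewrite rmorphB !aiK.
have s_mul : monoid_morphism s.
  split=> [|x y]; first by rewrite /s -[1](rmorph1 a) aK rmorph1.
  by rewrite /s -rmorphM; congr (b _); apply: (fmorph_inj a);
    rewrite rmorphM !aiK.
pose sA := GRing.isZmodMorphism.Build _ _ s s_add.
pose sM := GRing.isMonoidMorphism.Build _ _ s s_mul.
pose sR : {rmorphism L1 -> L2} := HB.pack s sA sM.
exists sR => [|x y /GG'/G'E[c [-> ->]]]; last by rewrite /= /s aK.
by exists (a \o bi) => [x|y] /=; rewrite /s ?bK ?aiK ?aK ?biK.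
Qed.

(** * Automorphisms and roots of unity *)

Definition base_aut (k L : fieldType) (iota : k -> L) (s : {rmorphism L -> L}) :
    Prop :=
  bijective s /\ forall a, s (iota a) = iota a.

Section BaseAut.
Context (k L : fieldType) (iota : {rmorphism k -> L}).

Lemma base_aut_comp s t : base_aut iota s -> base_aut iota t ->
  base_aut iota (s \o t : {rmorphism L -> L}).
Proof.
move=> [sbij sk] [tbij tk]; split; first exact: bij_comp.
by move=> a; rewrite /= tk sk.
Qed.

Lemma base_aut_inv s : base_aut iota s ->
  exists2 t, base_aut iota t & cancel s t /\ cancel t s.
Proof.
move=> [[t st ts] sk].
have t_add : zmod_morphism t.
  by move=> x y; apply: (can_inj st); rewrite rmorphB !ts.
have t_mul : monoid_morphism t.
  by split=> [|x y]; apply: (can_inj st); rewrite ?rmorph1 ?rmorphM !ts.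
pose tA := GRing.isZmodMorphism.Build _ _ t t_add.
pose tM := GRing.isMonoidMorphism.Build _ _ t t_mul.
pose tR : {rmorphism L -> L} := HB.pack t tA tM.
exists tR; last by split.
by split=> [|a]; [exists s | apply: (can_inj st); rewrite ts sk].
Qed.

Lemma sep_closure_conj (p : {poly k}) x y :
    is_separable_closure iota -> irreducible_poly p ->
    root (map_poly iota p) x -> root (map_poly iota p) y ->
  exists2 s, base_aut iota s & s x = y.
Proof.
move=> hL pirr px py.
have := @field_graph_adjoin k L L k idfun iota iota p x y pirr px py.
move=> /(sep_closure_iso hL hL)[s sbij sG]; exists s.
  split=> // a; apply: sG; exists a%:P.
  by rewrite map_polyC !hornerC.
by apply: sG; exists 'X; rewrite map_polyX !hornerX.
Qed.

(** If the minimal polynomial of [x] had degree above 1, its cofactor at [x] would have a root. That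
    root is conjugate to [x], hence equal to it, which contradicts separability. *)
Lemma sep_closure_fixed x :
    is_separable_closure iota -> (forall s, base_aut iota s -> s x = x) ->
  exists a, x = iota a.
Proof.
move=> hL fix_x; have [p [pmon pirr psep px]] := hL.1 x.
have /factor_theorem[r pr] := px.
have ipsep : separable_poly (map_poly iota p) by rewrite separable_map.
have r0 : r != 0.
  apply: contraTneq (separable_poly_neq0 ipsep) => r0.
  by rewrite pr r0 mul0r eqxx.
have rsep : separable_poly r.
  by apply: dvdp_separable ipsep; rewrite pr dvdp_mulr.
have [r1|r1] := ltnP 1 (size r).
  have [y ry] := hL.2 r rsep r1.
  have py : root (map_poly iota p) y by rewrite pr rootM ry.
  have [s sA sxy] := sep_closure_conj hL pirr px py.
  have /coprimep_root/(_ ry) : coprimep r ('X - x%:P).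
    by apply: (separable_coprime ipsep); rewrite pr.
  by rewrite -sxy fix_x // !hornerE subrr eqxx.
have sp2 : size p = 2.
  rewrite -(size_map_poly iota) pr size_mul ?polyXsubC_eq0 // size_XsubC addn2.
  by congr _.+1; apply/eqP; rewrite eqn_leq r1 size_poly_gt0.
exists (- p`_0); move/rootP: px.
rewrite (@horner_coef_wide _ 2); last by rewrite size_map_poly sp2.
rewrite !big_ord_recl big_ord0 !coef_map /= expr0 expr1 mulr1 addr0.
have -> : p`_1 = 1 by have /monicP := pmon; rewrite lead_coefE sp2.
by rewrite rmorph1 mul1r rmorphN addrC => /eqP; rewrite addr_eq0 => /eqP.
Qed.

End BaseAut.

Section RootsOfUnity.

Lemma prim_root_unit (L : fieldType) n (z : L) :
  n.-primitive_root z -> z \is a GRing.unit.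
Proof.
move=> zprim; rewrite -(unitrX_pos _ (prim_order_gt0 zprim)).
by rewrite (prim_expr_order zprim) unitr1.
Qed.

(** Factors of [n] equal to the characteristic are removed one at a time, because the Frobenius map
    is injective. *)
Lemma unity_root_prime_to_char (L : fieldType) n : (0 < n)%N ->
  exists m, [/\ (0 < m)%N, m%:R != 0 :> L
    & forall x : L, x ^+ n = 1 -> x ^+ m = 1].
Proof.
elim/ltn_ind: n => n IHn n_gt0; have [n0|n0] := eqVneq n%:R (0 : L); last first.
  by exists n.
have [p pL] : exists p, p \in [pchar L] by apply: (natf0_pchar n_gt0); apply/eqP.
have /dvdnP[d nd] : (p %| n)%N by rewrite (dvdn_pcharf pL) n0.
have p_gt1 := prime_gt1 (pcharf_prime pL).
have d_gt0 : (0 < d)%N by move: n_gt0; rewrite nd muln_gt0 => /andP[].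
have [|m [m0 mL xm]] := IHn d _ d_gt0; first by rewrite nd ltn_Pmulr.
exists m; split=> // x xn; apply: xm; apply: (fmorph_inj (pFrobenius_aut pL)).
by rewrite rmorph1 [LHS]pFrobenius_autE -exprM -nd.
Qed.

Lemma sep_closure_prim_root (k L : fieldType) (iota : {rmorphism k -> L}) n :
    is_separable_closure iota -> (0 < n)%N ->
  exists m (z : L), m.-primitive_root z /\ forall x : L, x ^+ n = 1 -> x ^+ m = 1.
Proof.
move=> hL n_gt0; have [m [m_gt0 mL xm]] := unity_root_prime_to_char L n_gt0.
have msep : separable_poly ('X^m - 1 : {poly L}) by apply: separable_Xn_sub_1.
have [rs rs_uniq rsE] := sep_closure_split hL msep.
have rs_unity : all m.-unity_root rs.
  apply/allP => x xrs; rewrite /root_of_unity (eqp_root rsE).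
  by rewrite root_prod_XsubC.
have rs_size : (m <= size rs)%N.
  by have := eqp_size rsE; rewrite size_prod_XsubC size_XnsubC // => -[->].
have /hasP[z _ zprim] := has_prim_root m_gt0 rs_unity rs_uniq rs_size.
by exists m, z.
Qed.

(** One exponent serves all roots of unity of order dividing [n], and hence all coordinates of a
    torsion point at once. *)
Lemma rmorph_unity_exp (L : fieldType) n (z : L) (s : {rmorphism L -> L}) :
    n.-primitive_root z ->
  exists i, forall x, x ^+ n = 1 -> s x = x ^+ i.
Proof.
move=> zprim; have [i si] : {i : 'I_n | s z = z ^+ i}.
  by apply: (prim_rootP zprim); rewrite -rmorphXn (prim_expr_order zprim) rmorph1.
exists i => x /(prim_rootP zprim)[j ->].
by rewrite rmorphXn si -!exprM mulnC.
Qed.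

(** The group generated by [xs] is cyclic; a generator is built by taking gcds of exponents of [z].
    Its membership in every subfield containing [xs] makes it a primitive element. *)
Lemma unity_root_generator (L : fieldType) n (z : L) (xs : seq L) :
    n.-primitive_root z -> (forall x, x \in xs -> x ^+ n = 1) ->
  exists t, [/\ t ^+ n = 1,
    forall P : {pred L}, divring_closed P -> {subset xs <= P} -> t \in P
  & forall x, x \in xs -> exists i, x = t ^+ i].
Proof.
move=> zprim; elim: xs => [|x xs IHxs] xs1.
  by exists 1; rewrite expr1n; split=> // P [].
have [y yxs|t [tn tP txs]] := IHxs; first by apply: xs1; rewrite inE yxs orbT.
have [a ta] := prim_rootP zprim tn.
have [b xb] := prim_rootP zprim (xs1 x (mem_head _ _)).
(* The exponent is shifted by [n] because [Bezoutl] requires a positive first argument. *)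
have a_gt0 : (0 < a + n)%N by rewrite addn_gt0 (prim_order_gt0 zprim) orbT.
have {}ta : t = z ^+ (a + n) by rewrite exprD (prim_expr_order zprim) mulr1.
pose g := gcdn (a + n) b.
have [c _ /dvdnP[e gce]] := Bezoutl b a_gt0.
(* Bezout in the form [g + c * b = e * (a + n)]. *)
have zg : z ^+ g = t ^+ e / x ^+ c.
  rewrite ta xb -!exprM mulnC -gce exprD [(c * b)%N]mulnC mulfK //.
  by rewrite expf_neq0 // -unitfE; apply: prim_root_unit zprim.
exists (z ^+ g); split.
- by rewrite -exprM mulnC exprM (prim_expr_order zprim) expr1n.
- move=> P Pdiv xsP; rewrite zg.
  have Pexp y i : y \in P -> y ^+ i \in P.
    have [P1 _ PV] := Pdiv => Py; elim: i => [|i IHi]; first by rewrite expr0.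
    have PyV : y^-1 \in P by rewrite -div1r; apply: PV.
    by have := PV _ _ IHi PyV; rewrite invrK -exprSr.
  have [_ _ PV] := Pdiv; apply: PV; apply: Pexp.
    by apply: tP => // y yxs; apply: xsP; rewrite inE yxs orbT.
  by apply: xsP; rewrite mem_head.
- have ht : exists i, t = (z ^+ g) ^+ i.
    by have /dvdnP[i ai] := dvdn_gcdl (a + n) b; exists i; rewrite -exprM mulnC -ai.
  move=> y; rewrite inE => /orP[/eqP->|/txs[i ->]].
    by have /dvdnP[i bi] := dvdn_gcdr (a + n) b; exists i; rewrite -exprM mulnC -bi.
  by have [j ->] := ht; exists (j * i)%N; rewrite exprM.
Qed.

End RootsOfUnity.

(** * Multivariate polynomials with integral coefficients *)

Section Mpoly.
Context (n : nat).

Lemma mpoly_rmorph_ext (R S : comNzRingType) (f g : {rmorphism {mpoly R[n]} -> S}) :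
    (forall c, f c%:MP = g c%:MP) -> (forall i, f 'X_i = g 'X_i) ->
  f =1 g.
Proof.
move=> fgC fgX p; rewrite [p]mpolyE !rmorph_sum; apply: eq_bigr => m _.
rewrite -mul_mpolyC !rmorphM fgC mpolyXE_id !rmorph_prod; congr (_ * _).
by apply: eq_bigr => i _; rewrite !rmorphXn fgX.
Qed.

Lemma map_mpoly_surj (R S : comNzRingType) (f : {rmorphism R -> S})
    (P : {mpoly S[n]}) :
  (forall m, exists a, P@_m = f a) -> exists p, map_mpoly f p = P.
Proof.
move=> /choice[a Pa]; exists (\sum_(m <- msupp P) a m *: 'X_[m]).
rewrite rmorph_sum [P in RHS]mpolyE; apply: eq_bigr => m _ /=.
by rewrite map_mpolyZ map_mpolyX Pa.
Qed.

Lemma meval_map_mpoly (R S : comNzRingType) (f : {rmorphism {mpoly R[n]} -> S})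
    (p : {mpoly R[n]}) :
  (map_mpoly (f \o @mpolyC n R) p).@[fun i => f 'X_i] = f p.
Proof.
pose ev := meval (fun i => f 'X_i) \o map_mpoly (f \o @mpolyC n R).
apply: (mpoly_rmorph_ext (f := ev)) => [c|i] /=.
  by rewrite map_mpolyC mevalC.
by rewrite map_mpolyX mevalXU.
Qed.

Section Integral.
Context (R K : comNzRingType) (f : {rmorphism R -> K}).

Definition integral_elts : {pred K} := fun x => `[< integralOver f x >].

Fact integral_elts_subring_closed : subring_closed integral_elts.
Proof.
split=> [|x y /asboolP xR /asboolP yR|x y /asboolP xR /asboolP yR]; apply/asboolP.
- exact: integral1.
- exact: integral_sub.
- exact: integral_mul.
Qed.

HB.instance Definition _ :=
  GRing.isSubringClosed.Build K integral_elts integral_elts_subring_closed.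

Lemma integral_mpoly (A : {mpoly K[n]}) :
  A \is a mpolyOver n integral_elts -> integralOver (map_mpoly (n := n) f) A.
Proof.
move=> /mpolyOverP AR; rewrite [A]mpolyE; apply: big_ind => [|B C|m _].
- exact: integral0.
- exact: integral_add.
- rewrite -mul_mpolyC; apply: integral_mul; last first.
    by rewrite -(map_mpolyX f); apply: integral_id.
  have /asboolP[p pmon pA] := AR m; exists (map_poly (@mpolyC n R) p).
    exact: monic_map.
  rewrite -map_poly_comp (eq_map_poly (g := @mpolyC n K \o f)).
    by rewrite map_poly_comp rmorph_root.
  by move=> a; rewrite /= map_mpolyC.
Qed.

End Integral.

(* A nonzero element of the domain [K[X]] integral over [F[X]] divides a
   nonzero element of [F[X]], so evaluation cannot kill it. *)
Lemma integral_meval_neq0 (F : comNzRingType) (K : fieldType)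
    (phi : {rmorphism {mpoly F[n]} -> K}) (A : {mpoly K[n]}) :
    (forall p, phi p = 0 -> p = 0) ->
    A \is a mpolyOver n (integral_elts (phi \o @mpolyC n F)) ->
  A.@[fun i => phi 'X_i] = 0 -> A = 0.
Proof.
move=> phi_inj /integral_mpoly[p pmon pA] evA; apply/eqP/negPn/negP => A0.
set i := map_mpoly _ in pA.
have: p != 0 by apply: monic_neq0.
elim/poly_ind: p pA {pmon} => [|q c IHq] pA; first by rewrite eqxx.
move: pA; rewrite /root rmorphD rmorphM /= map_polyX map_polyC !hornerE => pA.
(* Evaluation kills [A], so only the image of the constant term survives and [c] vanishes. The
   factor [A] can then be cancelled and the degree drops. *)
have c0 : c = 0.
  apply: phi_inj; rewrite -meval_map_mpoly; move/eqP: pA.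
  move=> /(congr1 (meval (fun j => phi 'X_j))).
  by rewrite mevalD mevalM evA mulr0 add0r meval0.
rewrite c0 polyC0 addr0 => qX; apply: IHq; last first.
  by apply: contraNneq qX => ->; rewrite mul0r.
by move: pA; rewrite c0 raddf0 addr0 mulf_eq0 (negPf A0) orbF.
Qed.

Lemma fraction_surj (R : idomainType) (x : {fraction R}) :
  exists2 pq : R * R, pq.2 != 0 & x = tofrac pq.1 / tofrac pq.2.
Proof.
elim/quotW: x => r; exists (frac r); first exact: denom_ratioP.
have d0 : tofrac (frac r).2 != 0 by rewrite tofrac_eq0 denom_ratioP.
apply: (mulIf d0); rewrite mulfVK //.
change (FracField.mul (\pi_(FracField.type R)%qT r) (tofrac (frac r).2) = tofrac (frac r).1).
rewrite !piE; apply/eqmodP => /=; rewrite FracField.equivfE /FracField.mulf.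
by rewrite !numden_Ratio ?mulf_neq0 ?oner_neq0 ?denom_ratioP // !mulr1 mulrC.
Qed.

(** A rational function integral over [F] is constant. The polynomial [x Q - P], with coefficients
    integral over [F], evaluates to 0, so it is 0; comparing at a monomial of [Q] shows [x] to be a
    quotient of elements of [F]. *)
Lemma integral_quotient_mpoly (F K : fieldType)
    (phi : {rmorphism {mpoly F[n]} -> K}) (P Q : {mpoly F[n]}) x :
    (forall p, phi p = 0 -> p = 0) -> Q != 0 -> x * phi Q = phi P ->
    integralOver (phi \o @mpolyC n F) x ->
  exists a : F, x = phi a%:MP.
Proof.
set f := _ \o _ => phi_inj Q0 xPQ xint.
pose A := x *: map_mpoly f Q - map_mpoly f P.
have A0 : A = 0.
  apply: (integral_meval_neq0 phi_inj).
    have fint a : f a \in integral_elts f by apply/asboolP/integral_id.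
    have Sx : x \in integral_elts f by apply/asboolP.
    apply/mpolyOverP => m; rewrite mcoeffB mcoeffZ !mcoeff_map_mpoly.
    by rewrite rpredB ?rpredM ?fint.
  by rewrite mevalB mevalZ !meval_map_mpoly xPQ subrr.
have := Q0; rewrite -msupp_eq0.
case: (msupp Q) (@mcoeff_msupp _ _ Q) => // m s /(_ m); rewrite mem_head => Qm _.
exists (P@_m / Q@_m).
have fQm : f Q@_m != 0 by rewrite fmorph_eq0 -Qm.
have /eqP : A@_m = 0 by rewrite A0 mcoeff0.
rewrite mcoeffB mcoeffZ !mcoeff_map_mpoly subr_eq0 => /eqP xQP.
by apply: (mulIf fQm); rewrite xQP -rmorphM /= -mpolyCM mulfVK // -Qm.
Qed.

End Mpoly.

(** * Products of linear forms *)

Section LinearForms.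
Context (n : nat) (i0 : 'I_n).

Definition linear_form (S : comNzRingType) (v : 'I_n -> S) : {mpoly S[n]} :=
  \sum_i v i *: 'X_i.

Lemma mcoeff_linear_form (S : comNzRingType) (v : 'I_n -> S) i :
  (linear_form v)@_U_(i) = v i.
Proof.
rewrite raddf_sum (bigD1 i) //= mcoeffZ mcoeffX eqxx mulr1 big1 ?addr0 //.
by move=> j ji; rewrite mcoeffZ mcoeffX eq_mnm1 (negPf ji) mulr0.
Qed.

Lemma map_linear_form (S T : comNzRingType) (g : {rmorphism S -> T})
    (v : 'I_n -> S) :
  map_mpoly g (linear_form v) = linear_form (g \o v).
Proof.
by rewrite rmorph_sum; apply: eq_bigr => i _ /=; rewrite map_mpolyZ map_mpolyX.
Qed.

(* Elimination of ['X_i0]: if [v i0 = 1], this is the reduction modulo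
   [linear_form v]. *)
Definition form_subst (R S : comNzRingType) (f : R -> S) (v : 'I_n -> S) : {mpoly R[n]} -> {mpoly S[n]} :=
  mmap (@mpolyC n S \o f)
    (fun i => if i == i0 then 'X_i - linear_form v else 'X_i).

HB.instance Definition _ (R S : comNzRingType) (f : {rmorphism R -> S}) v :=
  GRing.RMorphism.copy (form_subst f v) (mmap (@mpolyC n S \o f) _).

Lemma form_substC (R S : comNzRingType) (f : {rmorphism R -> S}) v c : form_subst f v c%:MP = (f c)%:MP.
Proof. exact: mmapC. Qed.

Arguments form_substC {R S} f v c.

Lemma form_substX (R S : comNzRingType) (f : {rmorphism R -> S}) v i :
  form_subst f v 'X_i = if i == i0 then 'X_i - linear_form v else 'X_i.
Proof. by rewrite /form_subst mmapX mmap1U. Qed.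

Arguments form_substX {R S} f v i.

Section FormSubst.
Context (R S : comNzRingType) (f : {rmorphism R -> S}).

Lemma map_form_subst (T : comNzRingType) (g : {rmorphism S -> T}) v p :
  map_mpoly g (form_subst f v p) = form_subst (g \o f) (g \o v) p.
Proof.
apply: (mpoly_rmorph_ext (f := map_mpoly g \o form_subst f v)) => [c|i] /=.
  by rewrite form_substC map_mpolyC (form_substC (g \o f : {rmorphism R -> T})).
rewrite (form_substX f) (form_substX (g \o f : {rmorphism R -> T})).
case: eqP => _; last exact: map_mpolyX.
by rewrite rmorphB /= map_mpolyX map_linear_form.
Qed.

Lemma form_subst_map v p :
  form_subst f v p = form_subst idfun v (map_mpoly f p).
Proof.
apply: (mpoly_rmorph_ext (g := form_subst idfun v \o map_mpoly f)) => [c|i] /=.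
  by rewrite map_mpolyC !form_substC.
by rewrite map_mpolyX !form_substX.
Qed.

End FormSubst.

(** Consequently a normalized form reduces to 0 along [v] only if it is the form of [v]. *)
Lemma form_subst_linear (S : comNzRingType) (v w : 'I_n -> S) : w i0 = 1 ->
  form_subst idfun v (linear_form w) = linear_form w - linear_form v.
Proof.
move=> w1; rewrite /linear_form rmorph_sum (bigD1 i0) //=.
rewrite [in RHS](bigD1 i0) //= -mul_mpolyC rmorphM /= form_substC form_substX.
rewrite eqxx /= mul_mpolyC w1 !scale1r addrAC; congr (_ + _ - _).
  by rewrite mul_mpolyC scale1r.
apply: eq_bigr => i ii0; rewrite -mul_mpolyC rmorphM /= form_substC form_substX.
by rewrite (negPf ii0) mul_mpolyC.
Qed.

Lemma form_subst_mod (S : comNzRingType) (v : 'I_n -> S) p :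
  exists d, p = form_subst idfun v p + linear_form v * d.
Proof.
pose P p := exists d, p = form_subst idfun v p + linear_form v * d.
have PM a b : P a -> P b -> P (a * b).
  (* With reductions [a'] and [b'], the witness comes from [ab - a'b' = (a - a')b + a'(b - b')]. *)
  move=> [d ad] [e be]; exists (d * b + form_subst idfun v a * e).
  rewrite rmorphM; move: ad be; set a' := form_subst _ _ a.
  set b' := form_subst _ _ b => ad be.
  rewrite {1}ad mulrDl {1}be !mulrDr -addrA; congr (_ + _).
  by rewrite addrC -mulrA; congr (_ + _); rewrite mulrCA.
rewrite -/(P p) [p]mpolyE; apply: big_ind => [|q r [d qd] [e re]|m _].
- by exists 0; rewrite rmorph0 mulr0 addr0.
- by exists (d + e); rewrite rmorphD mulrDr addrACA -qd -re.
- rewrite -mul_mpolyC; apply: (PM).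
    by exists 0; rewrite form_substC mulr0 addr0.
  rewrite mpolyXE_id; apply: big_ind => [|a b|i _]; last 1 first.
    elim: (m i) => [|j IHj]; first by exists 0; rewrite rmorph1 mulr0 addr0.
    rewrite exprS; apply: (PM) => //; rewrite /P form_substX; case: eqP => _.
      by exists 1; rewrite mulr1 subrK.
    by exists 0; rewrite mulr0 addr0.
    by exists 0; rewrite rmorph1 mulr0 addr0.
  exact: PM.
Qed.

(** The forms are divided out one by one: the form of [v] reduces along another [w] to a nonzero
    difference, which cancels in the domain, so the quotient still reduces to 0 along [w]. *)
Lemma prod_linear_form_dvd (S : idomainType) (vs : seq {ffun 'I_n -> S}) p :
    uniq vs -> {in vs, forall v : {ffun 'I_n -> S}, v i0 = 1} ->
    {in vs, forall v : {ffun 'I_n -> S}, form_subst idfun v p = 0} ->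
  exists d, p = (\prod_(v <- vs) linear_form v) * d.
Proof.
elim: vs p => [|v vs IHvs] p /= => [_ _ _|/andP[vvs vs_uniq] vs1 vsp].
  by exists p; rewrite big_nil mul1r.
have [d pd] := form_subst_mod v p.
have {}pd : p = linear_form v * d.
  by rewrite pd (vsp v (mem_head _ _)) add0r.
have [|w wvs|e de] := IHvs d vs_uniq.
- by move=> w wvs; apply: vs1; rewrite inE wvs orbT.
- have := vsp w; rewrite inE wvs orbT pd rmorphM /= form_subst_linear; last first.
    by apply: vs1; rewrite mem_head.
  move=> /(_ isT)/eqP; rewrite mulf_eq0 subr_eq0 => /orP[/eqP vw|/eqP //].
  case/negP: vvs; suff -> : v = w by [].
  by apply/ffunP => i; rewrite -!mcoeff_linear_form vw.
- by exists e; rewrite big_cons pd de mulrA.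
Qed.

Lemma prod_linear_form_irreducible (F L : fieldType) (f : {rmorphism F -> L})
    (vs : seq {ffun 'I_n -> L}) (p : {mpoly F[n]}) :
    uniq vs -> vs != [::] -> {in vs, forall v : {ffun 'I_n -> L}, v i0 = 1} ->
    {in vs &, forall v w : {ffun 'I_n -> L}, exists2 s : {rmorphism L -> L},
       forall a, s (f a) = f a & forall i, s (v i) = w i} ->
    map_mpoly f p = \prod_(v <- vs) linear_form v ->
  irreducible_elt p.
Proof.
move=> vs_uniq vs0 vs1 trans pE.
have subst0 v : v \in vs -> form_subst f v p = 0.
  move=> vvs; rewrite form_subst_map pE rmorph_prod (big_rem v) //=.
  by rewrite form_subst_linear ?subrr ?mul0r ?vs1.
have lin0 v : v \in vs -> linear_form v != 0.
  move=> vvs; apply/eqP => /(congr1 (mcoeff U_(i0))).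
  by rewrite mcoeff_linear_form mcoeff0 vs1 // => /eqP; rewrite oner_eq0.
have fp0 : map_mpoly f p != 0.
  by rewrite pE big_seq prodf_seq_eq0 -all_predC; apply/allP => v vvs /=;
    rewrite vvs lin0.
have p0 : p != 0 by apply: contraNneq fp0 => ->; rewrite rmorph0.
have [v vvs] : exists v, v \in vs.
  by case: (vs) vs0 => // v ws _; exists v; rewrite mem_head.
split=> // [|a b pab].
  apply/negP => /(rmorph_unit (form_subst f v)).
  by rewrite [X in X \is a _](subst0 v vvs) unitr0.
(* A factor that vanishes along one [v] is divisible by the whole product, so its cofactor is a
   unit. *)
have main c d : p = c * d -> form_subst f v c = 0 -> d \is a GRing.unit.
  move=> pcd c0.
  have [|e ce] := @prod_linear_form_dvd _ vs (map_mpoly f c) vs_uniq vs1.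
    (* Applying [s] to the coefficients fixes [c], defined over [F], and carries the reduction along
       [v] to the one along [w]. *)
    move=> w wvs; have [s sf svw] := trans v w vvs wvs.
    have -> : w = s \o v :> ('I_n -> L) by apply/funext => i /=; rewrite (svw, sf).
    rewrite -form_subst_map.
    have -> : f = s \o f :> (F -> L) by apply/funext => i /=; rewrite (svw, sf).
    by rewrite -map_form_subst c0 raddf0.
  have fc0 : map_mpoly f c != 0.
    by apply: contraNneq fp0; rewrite pcd rmorphM /= => ->; rewrite mul0r.
  have de1 : map_mpoly f d * e = 1.
    by apply: (mulfI fc0); rewrite mulr1 mulrA -rmorphM -pcd /= pE -ce.
  (* Units are the constant polynomials with unit constant term, a property that descends from [L]
     to [F]. *)
  have /andP[/eqP dC d_unit] : map_mpoly f d \is a GRing.unit.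
    by apply/unitrPr; exists e.
  apply/andP; split; last by move: d_unit; rewrite mcoeff_map_mpoly !unitfE fmorph_eq0.
  apply/eqP/mpolyP => m; apply: (fmorph_inj f).
  by rewrite -mcoeff_map_mpoly dC !mcoeffC rmorphM rmorph_nat mcoeff_map_mpoly.
have /eqP : form_subst f v p = 0 by apply: subst0.
rewrite {1}pab rmorphM mulf_eq0 => /orP[] /eqP ab0; apply/orP.
  by right; apply: main ab0.
by left; apply: main ab0; rewrite mulrC.
Qed.

End LinearForms.

(** * Torsion points and their conjugates *)

Section Torus.
Context (k L : fieldType) (iota : {rmorphism k -> L}) (N : nat).
Implicit Types x y z : torus N L.

Lemma torus_expE x n i : uval ((x ^+ n)%g i) = uval (x i) ^+ n.
Proof.
elim: n => [|n IHn]; first by rewrite expg0 expr0 ffunE.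
by rewrite expgS exprS ffunE /= IHn.
Qed.

(** Field morphisms preserve nonzero elements, so [insubd] returns the image itself as a unit. *)
Definition torus_map (s : {rmorphism L -> L}) x : torus N L :=
  [ffun i => insubd (units_one L) (s (uval (x i)))].

Lemma torus_mapE s x i : uval (torus_map s x i) = s (uval (x i)).
Proof. by rewrite ffunE insubdK // unfold_in fmorph_eq0 uval_neq0. Qed.

Lemma torus_eqP x y : (forall i, uval (x i) = uval (y i)) -> x = y.
Proof. by move=> xy; apply/ffunP => i; apply: val_inj; apply: xy. Qed.

Lemma galois_conjugateP x y :
  galois_conjugate iota x y <-> exists2 s, base_aut iota s & y = torus_map s x.
Proof.
split=> [[s [sbij sk sxy]]|[s [sbij sk] ->]].
  by exists s => //; apply: torus_eqP => i; rewrite torus_mapE sxy.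
by exists s; split=> // i; rewrite torus_mapE.
Qed.

Lemma galois_conjugate_refl x : galois_conjugate iota x x.
Proof. by exists idfun; split=> //; exists id. Qed.

Lemma galois_conjugate_sym x y :
  galois_conjugate iota x y -> galois_conjugate iota y x.
Proof.
move=> /galois_conjugateP[s /base_aut_inv[t tA [st _]] ->].
apply/galois_conjugateP; exists t => //.
by apply: torus_eqP => i; rewrite !torus_mapE st.
Qed.

Lemma galois_conjugate_trans x y z :
  galois_conjugate iota x y -> galois_conjugate iota y z ->
  galois_conjugate iota x z.
Proof.
move=> /galois_conjugateP[s sA ->] /galois_conjugateP[t tA ->].
apply/galois_conjugateP; exists (t \o s : {rmorphism L -> L}).
  exact: base_aut_comp.
by apply: torus_eqP => i; rewrite !torus_mapE.
Qed.

Lemma tmonom_map (s : {rmorphism L -> L}) x m :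
  tmonom (torus_map s x) m = s (tmonom x m).
Proof.
by rewrite rmorph_prod; apply: eq_bigr => i _; rewrite torus_mapE fmorphXz.
Qed.

Lemma tmonom0 x : tmonom x 0 = 1.
Proof. by apply: big1 => i _; rewrite mxE expr0z. Qed.

Lemma tmonom_unity x n m :
  (forall i, uval (x i) ^+ n = 1) -> tmonom x m ^+ n = 1.
Proof.
move=> xn; rewrite -prodrXl; apply: big1 => i _ /=.
by rewrite exprnP exprz_exp mulrC -exprz_exp -exprnP xn exp1rz.
Qed.

Context (hL : is_separable_closure iota).

Lemma torsion_unity x : torsion x ->
  exists n (z : L), n.-primitive_root z /\ forall i, uval (x i) ^+ n = 1.
Proof.
case=> n n_gt0 xn; have [m [z [zprim zm]]] := sep_closure_prim_root hL n_gt0.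
exists m, z; split=> // i; apply: zm.
by rewrite -torus_expE xn ffunE.
Qed.

Lemma torsion_conjugate_exp x y : torsion x -> galois_conjugate iota x y ->
  exists j, y = (x ^+ j)%g.
Proof.
move=> /torsion_unity[n [z [zprim xn]]] /galois_conjugateP[s _ ->].
have [j sj] := rmorph_unity_exp s zprim; exists j.
by apply: torus_eqP => i; rewrite torus_mapE torus_expE sj.
Qed.

(** All conjugates are powers of [x], so the orbit is cut out of a finite list of powers. *)
Lemma torsion_orbit_finite x : torsion x ->
  exists S : {fset torus N L}, forall z, z \in S <-> galois_conjugate iota x z.
Proof.
move=> tx; have [n n_gt0 xn] := tx.
pose T := [fset (x ^+ j)%g | j in seq.iota 0 n]%fset.
exists [fset z in T | `[< galois_conjugate iota x z >]]%fset => z.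
rewrite !inE; split=> [/andP[_ /asboolP] //|xz].
apply/andP; split; last exact/asboolP.
have [j ->] := torsion_conjugate_exp tx xz.
apply/imfsetP; exists (j %% n)%N; first by rewrite /= mem_iota ltn_mod.
by rewrite {1}(divn_eq j n) expgnDr mulnC expgnA xn expg1n mul1g.
Qed.

End Torus.

(** * The orbit of the generic form *)

Section GenericForms.
Context (F : fieldType) (N : nat) (M : {fset 'rV[int]_N}) (hM : 0 \in M).
Context (Kbar : fieldType).
Context (iota : {rmorphism {fraction (coef_ring F M)} -> Kbar}).
Context (hL : is_separable_closure iota).
Implicit Types x y z xi : torus N Kbar.

Local Notation n := #|{: M}|.
Local Notation vect := {ffun 'I_n -> Kbar}.

Let phi : {rmorphism {mpoly F[n]} -> Kbar} := iota \o @tofrac (coef_ring F M).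
Let base : {rmorphism F -> Kbar} := base_embed iota.
(** The index of the exponent 0, whose monomial is 1: it normalizes all the forms below. *)
Let i0 : 'I_n := enum_rank [` hM]%fset.

Lemma coef_embed_eq0 (p : {mpoly F[n]}) : phi p = 0 -> p = 0.
Proof. by move=> /eqP; rewrite fmorph_eq0 tofrac_eq0 => /eqP. Qed.

Definition monom_vect x : vect := [ffun i => tmonom x (val (enum_val i))].

Definition form_value (v : vect) : Kbar :=
  (linear_form v).@[fun i => phi 'X_i].

Lemma form_valueE (v : vect) :
  form_value v = \sum_(m : M) coef_embed iota (indet F m) * v (enum_rank m).
Proof.
rewrite /form_value raddf_sum (reindex enum_rank) /=; last first.
  exact/onW_bij/enum_rank_bij.
by apply: eq_bigr => m _; rewrite mevalZ mevalXU mulrC.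
Qed.

Lemma generic_evalE x :
  laurent_eval (coef_embed iota) (generic_laurent F M) x =
    form_value (monom_vect x).
Proof.
rewrite generic_value form_valueE; apply: eq_bigr => m _.
by rewrite ffunE enum_rankK.
Qed.

Lemma monom_vect_i0 x : monom_vect x i0 = 1.
Proof. by rewrite ffunE enum_rankK tmonom0. Qed.

Lemma monom_vect_map (s : {rmorphism Kbar -> Kbar}) x :
  monom_vect (torus_map s x) = [ffun i => s (monom_vect x i)].
Proof. by apply/ffunP => i; rewrite !ffunE tmonom_map. Qed.

(** A set, so that a vector shared by several conjugates is counted once. *)
Definition orbit_forms (S : {fset torus N Kbar}) : {fset vect} :=
  [fset monom_vect z | z in S]%fset.

Section Orbit.
Context (xi : torus N Kbar) (S : {fset torus N Kbar}).
Context (txi : torsion xi).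
Context (hS : forall z, z \in S <-> galois_conjugate iota xi z).

Local Notation V := (orbit_forms S).

Lemma orbit_formsP v : v \in V <->
  exists2 s, base_aut iota s & v = monom_vect (torus_map s xi).
Proof.
split=> [/imfsetP[z /= /hS/galois_conjugateP[s sA ->] ->]|[s sA ->]].
  by exists s.
by apply/imfsetP; exists (torus_map s xi) => //=; apply/hS/galois_conjugateP;
  exists s.
Qed.

Lemma monom_vect_orbit : monom_vect xi \in V.
Proof.
by apply/imfsetP; exists xi => //=; apply/hS; apply: galois_conjugate_refl.
Qed.

Lemma orbit_forms_map s v : base_aut iota s -> v \in V ->
  [ffun i => s (v i)] \in V.
Proof.
move=> sA /orbit_formsP[t tA ->]; apply/orbit_formsP.
exists (s \o t : {rmorphism Kbar -> Kbar}); first exact: base_aut_comp.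
by rewrite !monom_vect_map; apply/ffunP => i; rewrite !ffunE.
Qed.

Lemma orbit_forms_i0 v : v \in V -> v i0 = 1.
Proof. by case/orbit_formsP => s _ ->; apply: monom_vect_i0. Qed.

Lemma map_prod_orbit_forms s : base_aut iota s ->
  map_mpoly s (\prod_(v <- V) linear_form v) = \prod_(v <- V) linear_form v.
Proof.
move=> sA; rewrite rmorph_prod.
pose h (v : vect) : vect := [ffun i => s (v i)].
have h_inj : injective h.
  by move=> v w /ffunP vw; apply/ffunP => i; have := vw i; rewrite !ffunE => /fmorph_inj.
have VE : V = [fset h v | v in V]%fset.
  apply/fsetP => v; apply/idP/imfsetP => [vV|[w wV ->]]; last exact: orbit_forms_map.
  have [t tA [_ ts]] := base_aut_inv sA.
  exists [ffun i => t (v i)]; first exact: orbit_forms_map.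
  by apply/ffunP => i; rewrite !ffunE ts.
rewrite [in RHS]VE [RHS]big_imfset /=; last by move=> v w _ _; apply: h_inj.
apply: eq_bigr => v _; rewrite map_linear_form; apply: eq_bigr => i _.
by rewrite ffunE.
Qed.

Lemma orbit_forms_integral v : v \in V ->
  linear_form v \is a mpolyOver n (integral_elts base).
Proof.
case/orbit_formsP => s _ ->; apply: rpred_sum => i _.
apply: mpolyOverZ; last exact: mpolyOverX.
have [m [zeta [zprim xm]]] := torsion_unity hL txi.
rewrite monom_vect_map !ffunE; apply/asboolP; exists ('X^m - 1).
  by rewrite monicXnsubC // (prim_order_gt0 zprim).
rewrite rmorphB rmorph1 /= map_polyXn rootE !hornerE -rmorphXn.
by rewrite (tmonom_unity _ xm) rmorph1 subrr.
Qed.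

(** Each coefficient is fixed by the automorphisms over [K], so it lies in [K]; it is also integral
    over [F], so it is a constant. *)
Lemma orbit_poly_exists :
  exists p : {mpoly F[n]}, map_mpoly base p = \prod_(v <- V) linear_form v.
Proof.
apply: map_mpoly_surj => m.
set c := _@_m.
have cint : integralOver base c.
  apply/asboolP; rewrite -/(integral_elts base c).
  have /mpolyOverP/(_ m) // : \prod_(v <- V) linear_form v
      \is a mpolyOver n (integral_elts base).
  by rewrite big_seq; apply: rpred_prod => v /orbit_forms_integral.
have [a ca] : exists a, c = iota a.
  apply: (sep_closure_fixed hL) => s sA.
  by rewrite /c -mcoeff_map_mpoly map_prod_orbit_forms.
have [[P Q] /= Q0 aPQ] := fraction_surj a.
have fQ0 : tofrac Q != 0 by rewrite tofrac_eq0.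
apply: (integral_quotient_mpoly coef_embed_eq0 Q0 (P := P)) => //.
by rewrite ca aPQ /phi /= -rmorphM mulfVK.
Qed.

Lemma orbit_poly_irreducible (p : {mpoly F[n]}) :
  map_mpoly base p = \prod_(v <- V) linear_form v -> irreducible_elt p.
Proof.
apply: (@prod_linear_form_irreducible _ i0) => [||v|v w].
- exact: fset_uniq.
- apply: contraTneq monom_vect_orbit => V0.
  by rewrite -[_ \in _]/(monom_vect xi \in (V : seq _)) V0.
- exact: orbit_forms_i0.
- move=> /orbit_formsP[s sA ->] /orbit_formsP[t tA ->].
  have [s' s'A [ss' s's]] := base_aut_inv sA.
  exists (t \o s' : {rmorphism Kbar -> Kbar}) => [a|i].
    by rewrite (base_aut_comp tA s'A).2.
  by rewrite !monom_vect_map !ffunE /= ss'.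
Qed.

Lemma orbit_poly_value (p : {mpoly F[n]}) :
    map_mpoly base p = \prod_(v <- V) linear_form v ->
  coef_embed iota p = \prod_(v <- V) form_value v.
Proof.
move=> pV; transitivity (map_mpoly base p).@[fun i => phi 'X_i].
  exact/esym/(meval_map_mpoly phi).
by rewrite pV rmorph_prod.
Qed.

Local Notation E := (adjoin_field base (monom_set M xi)).

Definition galois_vect (tau : E -> E) : vect :=
  [ffun i => val (tau (xi_pow iota xi (enum_val i)))].

(* [p] has coefficients in [F], so its vanishing under elimination along
   [monom_vect xi] is transported by [tau]; hence the form of [galois_vect tau]
   divides the product of the orbit forms and is one of them. *)
Lemma galois_vect_mem tau :
  galois_group base (monom_set M xi) tau -> galois_vect tau \in V.
Proof.
move=> [g [taug _ gF]]; have [p pV] := orbit_poly_exists.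
pose e : {rmorphism F -> E} := @to_adjoin _ _ base (monom_set M xi).
pose u : {rmorphism E -> Kbar} := @adjoin_incl _ _ base (monom_set M xi).
pose vE (i : 'I_n) : E := xi_pow iota xi (enum_val i).
have subst_p : form_subst i0 base (monom_vect xi) p = 0.
  rewrite form_subst_map pV rmorph_prod (big_rem _ monom_vect_orbit) /=.
  by rewrite form_subst_linear ?subrr ?mul0r ?monom_vect_i0.
have ue : u \o e = base :> (F -> Kbar) by [].
have uvE : u \o vE = monom_vect xi :> ('I_n -> Kbar).
  by apply/funext => i; rewrite ffunE.
have substE : form_subst i0 e vE p = 0.
  apply/mpolyP => m; apply: (fmorph_inj u); rewrite -mcoeff_map_mpoly.
  by rewrite map_form_subst uvE ue subst_p !mcoeff0 rmorph0.
have ge : g \o e = e :> (F -> E) by apply/funext => a /=; apply: gF.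
have : form_subst i0 base (galois_vect tau) p = 0.
  have -> : galois_vect tau = u \o (g \o vE) :> ('I_n -> Kbar).
    by apply/funext => i; rewrite ffunE taug.
  by rewrite -ue -map_form_subst -ge -map_form_subst substE !raddf0.
rewrite form_subst_map pV rmorph_prod => /eqP; rewrite prodf_seq_eq0.
case/hasP => v vV /=; rewrite form_subst_linear ?orbit_forms_i0 //.
rewrite subr_eq0 => /eqP vtau; suff <- : v = galois_vect tau by [].
by apply/ffunP => i; rewrite -!mcoeff_linear_form vtau.
Qed.

(** Injectivity holds because [tau] is determined on the generating monomials. For surjectivity, an
    automorphism of [Kbar] over [K] is restricted to [F(xi^M)]. *)
Lemma galois_vect_bij :
  set_bij (galois_group base (monom_set M xi)) [set` V]%classic galois_vect.
Proof.
split=> [tau /galois_vect_mem //|t1 t2|v].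
  rewrite !inE => -[g1 [tg1 _ g1F]] [g2 [tg2 _ g2F]] /ffunP t12.
  suff g12 : g1 =1 g2 by apply/funext => x; rewrite tg1 tg2.
  apply: adjoin_rmorph_ext => [a|x [m mM mx]].
    by rewrite (g1F _ a) // (g2F _ a).
  have -> : x = xi_pow iota xi [` mM]%fset by apply: val_inj; rewrite -mx.
  have := t12 (enum_rank [` mM]%fset).
  by rewrite !ffunE !enum_rankK tg1 tg2 => /val_inj.
move=> /orbit_formsP[s sA ->]; have [t tA [st ts]] := base_aut_inv sA.
(* The monomials are roots of unity, sent by [r] to powers of themselves, so the field is stable;
   the restricted inverse gives bijectivity. *)
have restr r : base_aut iota r -> exists g : {rmorphism E -> E},
    forall a, val (g a) = r (val a).
  move=> rA; apply: adjoin_restrict => [a|_ [m mM <-]]; first exact: rA.2.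
  have [k [zeta [zprim xk]]] := torsion_unity hL txi.
  have [j ->] := rmorph_unity_exp r zprim; last exact: tmonom_unity.
  by rewrite rpredX // adjoin_gen //; exists m.
have [g gs] := restr s sA; have [h ht] := restr t tA.
exists g.
  exists g; split=> //.
    by exists h => a; apply: val_inj; rewrite !(gs, ht) ?st ?ts.
  by move=> y a ya; apply: val_inj; rewrite gs ya; apply: sA.2.
rewrite monom_vect_map; apply/ffunP => i; rewrite !ffunE.
by rewrite gs.
Qed.

Lemma C_genericE : C_generic iota xi = \prod_(v <- V) form_value v.
Proof.
apply/esym; transitivity (\big[*%R/1]_(tau \in galois_group base (monom_set M xi))
    form_value (galois_vect tau)).
  rewrite [LHS]fsbig_seq ?fset_uniq //.
  exact: (@reindex_fsbig _ _ *%R _ _ _ _ _ form_value galois_vect_bij).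
apply: eq_fsbigr => tau _; rewrite form_valueE; apply: eq_bigr => m _.
by rewrite ffunE enum_rankK.
Qed.

End Orbit.
Lemma C_generic_irreducible xi :
  torsion xi -> irreducible_in_coef_ring iota (C_generic iota xi).
Proof.
move=> txi; have [S hS] := torsion_orbit_finite hL txi.
have [p pV] := orbit_poly_exists txi hS.
exists p; last exact: orbit_poly_irreducible hS _ pV.
by rewrite (C_genericE txi hS) (orbit_poly_value pV).
Qed.

(** The value is one factor of the image of a nonzero polynomial under an injective map. *)
Lemma generic_eval_neq0 xi : torsion xi ->
  laurent_eval (coef_embed iota) (generic_laurent F M) xi != 0.
Proof.
move=> txi; have [S hS] := torsion_orbit_finite hL txi.
have [p pV] := orbit_poly_exists txi hS.
have [p0 _ _] := orbit_poly_irreducible hS pV.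
have : coef_embed iota p != 0 by rewrite fmorph_eq0 tofrac_eq0.
rewrite (orbit_poly_value pV) prodf_seq_neq0 => /allP.
move=> /(_ (monom_vect xi)) /= ev; rewrite generic_evalE; apply: ev.
exact: monom_vect_orbit.
Qed.

End GenericForms.

(** * Degrees of field extensions *)

Section FieldDegree.

(** The two change of basis matrices multiply to the identity of size [d1], whose rank is at most
    [d2]. *)
Lemma field_basis_le (L : fieldType) (E0 : divringClosed L) (E : {pred L})
    d1 d2 (b1 : 'I_d1 -> L) (b2 : 'I_d2 -> L) :
  is_field_basis E0 E b1 -> is_field_basis E0 E b2 -> (d1 <= d2)%N.
Proof.
move=> [b1E span1] [b2E span2].
have /choice[A HA] i : exists c : {ffun 'I_d2 -> L},
    (forall j, c j \in E0) /\ b1 i = \sum_j c j * b2 j.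
  by have [c [cP _]] := span2 _ (b1E i); exists c.
have /choice[B HB] j : exists c : {ffun 'I_d1 -> L},
    (forall i, c i \in E0) /\ b2 j = \sum_i c i * b1 i.
  by have [c [cP _]] := span1 _ (b2E j); exists c.
pose MA := \matrix_(i, j) A i j; pose MB := \matrix_(j, i) B j i.
suff AB1 : MA *m MB = 1%:M.
  by rewrite -(mxrank1 L d1) -AB1 (leq_trans (mxrankM_maxl _ _)) // rank_leq_col.
apply/matrixP => i l; have [c [_ c_uniq]] := span1 _ (b1E i).
(* Row [i] of the product and row [i] of the identity both give coordinates of [b1 i] in the basis
   [b1], so uniqueness identifies them. *)
transitivity (c l).
  rewrite (c_uniq [ffun l => (MA *m MB) i l]) ?ffunE //; split=> [l'|].
    rewrite ffunE mxE rpred_sum // => j _; rewrite !mxE rpredM //.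
      exact: (HA i).1.
    exact: (HB j).1.
  rewrite {1}(HA i).2; transitivity (\sum_j \sum_l' A i j * (B j l' * b1 l')).
    by apply: eq_bigr => j _; rewrite {1}(HB j).2 mulr_sumr.
  rewrite exchange_big; apply: eq_bigr => l' _; rewrite ffunE mxE mulr_suml.
  by apply: eq_bigr => j _; rewrite !mxE mulrA.
rewrite (c_uniq [ffun l => (i == l)%:R]) ?ffunE ?mxE //; split=> [l'|].
  by rewrite ffunE rpred_nat.
rewrite (bigD1 i) //= ffunE eqxx mul1r big1 ?addr0 // => l' l'i.
by rewrite ffunE eq_sym (negPf l'i) mul0r.
Qed.

Lemma field_degreeE (L : fieldType) (E0 : divringClosed L) (E : {pred L})
    d (b : 'I_d -> L) :
  is_field_basis E0 E b -> field_degree E0 E = d.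
Proof.
move=> bP; apply: xget_unique; first by exists b.
move=> d' [b' b'P]; apply/eqP; rewrite eqn_leq.
by rewrite (field_basis_le b'P bP) (field_basis_le bP b'P).
Qed.

(** Every generator is a power of [t], so each element is a polynomial in [t]; the remainder modulo
    [p] gives its coordinates. *)
Lemma primitive_power_basis (k L : fieldType) (iota : {rmorphism k -> L})
    (A B : set L) (t : L) (p : {poly adjoin_field iota A}) :
    (forall x, A x -> x \in adjoin iota B) ->
    t \in adjoin iota B ->
    (forall x, B x -> exists i, x = t ^+ i) ->
    irreducible_poly p -> root (map_poly (@adjoin_incl _ _ iota A) p) t ->
  is_field_basis (adjoin iota A) (adjoin iota B)
    (fun i : 'I_(size p).-1 => t ^+ i).
Proof.
move=> AB tB Bt pirr pt; set d := (size p).-1.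
pose j : {rmorphism adjoin_field iota A -> L} := @adjoin_incl _ _ iota A.
pose h : {rmorphism k -> adjoin_field iota A} := @to_adjoin _ _ iota A.
have p_gt0 : (0 < size p)%N by rewrite (ltn_trans _ pirr.1).
have hornerE_ord (q : {poly adjoin_field iota A}) : (size q <= d)%N ->
    (map_poly j q).[t] = \sum_(i < d) val q`_i * t ^+ i.
  move=> qd; rewrite (horner_coef_wide _ (n := d)) ?size_map_poly //.
  by apply: eq_bigr => i _; rewrite coef_map.
split=> [i|x xB]; first by rewrite rpredX.
(* Taking [t] for both roots, the diagonal graph shows that the values of polynomials at [t] form a
   field. *)
have [Gk GB Gd _] := field_graph_adjoin h pirr pt pt.
pose P : {pred L} := fun x => `[< exists q : {poly adjoin_field iota A},
  (x, x) = ((map_poly j q).[t], (map_poly j q).[t]) >].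
have Pdiv : divring_closed P.
  split=> [|y z /asboolP Py /asboolP Pz|y z /asboolP Py /asboolP Pz]; apply/asboolP.
  - by exists 1; rewrite rmorph1 hornerC.
  - exact: GB Py Pz.
  - exact: Gd Py Pz.
have /asboolP[q [xq _]] : x \in P.
  apply: (adjoin_min Pdiv) xB => [a|y By]; apply/asboolP; first exact: Gk.
  have [i ->] := Bt y By; exists 'X^i.
  by rewrite map_polyXn hornerXn.
pose r := q %% p.
have rd : (size r <= d)%N.
  by rewrite -ltnS prednK // ltn_modp irredp_neq0.
have xr : x = \sum_(i < d) val r`_i * t ^+ i.
  rewrite -hornerE_ord // xq {1}(divp_eq q p) rmorphD rmorphM /= hornerD hornerM.
  by have /eqP -> := pt; rewrite mulr0 add0r.
exists [ffun i : 'I_d => val r`_i]; split.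
  split=> [i|]; first by rewrite ffunE; apply: valP.
  by rewrite xr; apply: eq_bigr => i _; rewrite ffunE.
(* Another expansion gives a polynomial [u] with the same value at [t]; [p] divides [u - r], whose
   size is below that of [p], so [u = r]. *)
move=> c [cA xc]; pose u := rVpoly (\row_i (AdjoinField (cA i))).
have ud : (size u <= d)%N by apply: size_poly.
have pur : p %| u - r.
  rewrite -(irreducible_root_dvdp _ pirr pt) rmorphB rootE hornerD hornerN subr_eq0.
  rewrite !hornerE_ord // -xr xc; apply/eqP/eq_bigr => i _.
  by rewrite coef_rVpoly_ord mxE.
have : u - r == 0.
  apply: contraLR pur => ur0; apply/negP => /(dvdp_leq ur0) pd.
  have : (size p <= d)%N.
    rewrite (leq_trans pd) // (leq_trans (size_polyD _ _)) // size_polyN.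
    by rewrite geq_max ud rd.
  by rewrite -(prednK p_gt0) ltnn.
rewrite subr_eq0 => /eqP ur.
by apply/ffunP => i; rewrite ffunE -ur coef_rVpoly_ord mxE.
Qed.

End FieldDegree.

(** * The product over a Galois orbit *)

Section OrbitProduct.
Context (F : fieldType) (N : nat) (M : {fset 'rV[int]_N}) (hM : 0 \in M).
Context (Kbar : fieldType).
Context (iota : {rmorphism {fraction (coef_ring F M)} -> Kbar}).
Context (hL : is_separable_closure iota).
Implicit Types x y z : torus N Kbar.
Context (xi : torus N Kbar) (S : {fset torus N Kbar}).
Context (txi : torsion xi).
Context (hS : forall z, z \in S <-> galois_conjugate iota xi z).

Local Notation fiber v := (count (fun z => monom_vect M z == v) S).

Lemma torus_map_inj (s : {rmorphism Kbar -> Kbar}) :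
  injective (@torus_map Kbar N s).
Proof.
move=> x y /ffunP xy; apply: torus_eqP => i; apply: (fmorph_inj s).
by rewrite -!torus_mapE xy.
Qed.

(** An automorphism permutes the orbit and carries the fibre over a vector onto the fibre over its
    image. *)
Lemma orbit_fiber_const v : v \in orbit_forms M S ->
  fiber v = fiber (monom_vect M xi).
Proof.
move=> /(orbit_formsP hS)[s sA ->].
have SE : perm_eq [seq torus_map s z | z <- S] S.
  apply: uniq_perm; rewrite ?map_inj_uniq ?fset_uniq //; first exact: torus_map_inj.
  move=> z; apply/mapP/idP => [[y /hS xiy ->]|/hS xiz].
    apply/hS; apply: galois_conjugate_trans xiy _.
    by apply/galois_conjugateP; exists s.
  have [t tA [_ ts]] := base_aut_inv sA.
  exists (torus_map t z); last by apply: torus_eqP => i; rewrite !torus_mapE ts.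
  apply/hS; apply: galois_conjugate_trans xiz _.
  by apply/galois_conjugateP; exists t.
rewrite -(permP SE) count_map; apply: eq_count => z /=.
rewrite !monom_vect_map; apply/eqP/eqP => [/ffunP sE|-> //].
by apply/ffunP => i; have := sE i; rewrite !ffunE => /fmorph_inj.
Qed.

Lemma tmonom_adjoin m : tmonom xi m \in adjoin iota (point_set xi).
Proof.
apply: rpred_prod => i _.
have xiE : uval (xi i) \in adjoin iota (point_set xi).
  by apply: adjoin_gen; exists i.
by case: (m 0 i) => j; rewrite ?NegzE -?exprnN ?rpredV rpredX.
Qed.

Lemma orbit_fiber_degree : fiber (monom_vect M xi) = C_exponent iota xi.
Proof.
set A := monom_set M xi; set B := point_set xi.
pose j : {rmorphism adjoin_field iota A -> Kbar} := @adjoin_incl _ _ iota A.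
have hj : is_separable_closure j.
  exact: (@sep_closure_tower _ _ _ (@to_adjoin _ _ iota A) j iota).
have [n [zeta [zprim xin]]] := torsion_unity hL txi.
have [|t [_ tP txi']] := @unity_root_generator _ n zeta
    [seq uval (xi i) | i <- enum 'I_N] zprim.
  by move=> _ /mapP[i _ ->].
have tB : t \in adjoin iota B.
  apply: tP => [|_ /mapP[i _ ->]]; first exact: adjoin_divring_closed.
  by apply: adjoin_gen; exists i.
have /choice[e et] i : exists d, uval (xi i) = t ^+ d.
  by apply: txi'; apply: map_f; rewrite mem_enum.
have [p [pmon pirr psep pt]] := hj.1 t.
have -> : C_exponent iota xi = (size p).-1.
  apply: field_degreeE (primitive_power_basis _ tB _ pirr pt).
    by move=> _ [m _ <-]; apply: tmonom_adjoin.
  by move=> _ [i _ <-]; exists (e i).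
have [|rs rs_uniq rsE] := sep_closure_split hL (q := map_poly j p).
  by rewrite separable_map.
have -> : (size p).-1 = size rs.
  by rewrite -(size_map_poly j) (eqp_size rsE) size_prod_XsubC.
(* The roots of [p] are the conjugates of [t] over [K(xi^M)]. *)
have rsP (y : Kbar) : y \in rs <-> exists2 s, base_aut j s & s t = y.
  rewrite -root_prod_XsubC -(eqp_root rsE); split=> [py|[s sA <-]].
    exact: (sep_closure_conj hj pirr pt py).
  have -> : map_poly j p = map_poly s (map_poly j p).
    by rewrite -map_poly_comp; apply: eq_map_poly => a; rewrite /= sA.2.
  exact: rmorph_root.
(* A conjugate of [t] determines a conjugate of [xi] through the exponents that express the
   coordinates as powers of [t]. *)
pose g (y : Kbar) : torus N Kbar := [ffun i => insubd (units_one Kbar) (y ^+ e i)].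
have gE (s : {rmorphism Kbar -> Kbar}) : g (s t) = torus_map s xi.
  by apply/ffunP => i; rewrite !ffunE -rmorphXn -et.
have baseA (s : {rmorphism Kbar -> Kbar}) : base_aut j s -> base_aut iota s.
  move=> [sbij sj]; split=> // a.
  exact: (sj (to_adjoin iota A a)).
have g_inj : {in rs &, injective g}.
  move=> _ _ /rsP[s1 s1A <-] /rsP[s2 s2A <-]; rewrite !gE => /ffunP s12.
  apply: (rmorph_adjoin_ext (iota := iota) (A := B)) => // [a|_ [i _ <-]].
    by rewrite (baseA _ s1A).2 (baseA _ s2A).2.
  by rewrite -!torus_mapE s12.
rewrite -size_filter -(size_map g); apply/perm_size/uniq_perm.
- exact/filter_uniq/fset_uniq.
- by rewrite map_inj_in_uniq.
- move=> z; rewrite mem_filter; apply/andP/mapP => [[/eqP zE /hS]|].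
    move=> /galois_conjugateP[s [sbij sk] zs]; exists (s t); last by rewrite gE.
    apply/rsP; exists s => //; split=> // a.
    (* Equality of monomial vectors says that [s] fixes the generators of [K(xi^M)], hence the whole
       field. *)
    apply: (rmorph_adjoin_ext (iota := iota) (A := A) (f := s)
              (g := idfun)) (valP a) => // _ [m mM <-].
    rewrite -tmonom_map -zs; move/ffunP/(_ (enum_rank [` mM]%fset)): zE.
    by rewrite !ffunE !enum_rankK.
  move=> [_ /rsP[s sA <-] ->]; rewrite gE; split; last first.
    by apply/hS/galois_conjugateP; exists s => //; apply: baseA.
  apply/eqP/ffunP => i; rewrite monom_vect_map !ffunE.
  set m := enum_val i; have Am : A (tmonom xi (val m)).
    by exists (val m) => //=; apply: valP.
  exact: (sA.2 (AdjoinField (adjoin_gen iota Am))).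
Qed.

Lemma orbit_product :
  \prod_(z <- S) laurent_eval (coef_embed iota) (generic_laurent F M) z =
    C_generic iota xi ^+ C_exponent iota xi.
Proof.
rewrite (C_genericE hM hL txi hS) -prodrXl.
rewrite (partition_big_imfset _ (fun z => monom_vect M z)) /= -/(orbit_forms M S).
rewrite big_seq [RHS]big_seq; apply: eq_bigr => v vV.
rewrite -orbit_fiber_degree -(orbit_fiber_const vV).
under eq_bigr => z /eqP zv do rewrite generic_evalE zv.
by rewrite big_const_seq iter_mulr_1.
Qed.

End OrbitProduct.

(** * Cyclic subgroups *)

Section Generators.

Lemma finite_subgroup_exp (G : groupType) (H : {fset G}) (x : G) :
  finite_subgroup H -> x \in H -> forall n, (x ^+ n)%g \in H.
Proof.
move=> hH xH; elim=> [|n IHn]; first by rewrite expg0; apply: hH.1.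
by rewrite expgS; apply: (group_closedM hH).
Qed.

Lemma finite_subgroup_torsion (G : groupType) (H : {fset G}) (x : G) :
  finite_subgroup H -> x \in H -> torsion x.
Proof.
move=> hH xH; have xnH := finite_subgroup_exp hH xH.
pose s := [seq (x ^+ n)%g | n <- iota 0 (size H).+1].
(* Pigeonhole: one more power is listed than [H] has elements. *)
have /(uniqPn 1%g)[i [j [ij js]]] : ~~ uniq s.
  apply/negP => s_uniq; have : (size s <= size H)%N.
    by apply: uniq_leq_size => // _ /mapP[n _ ->].
  by rewrite size_map size_iota ltnn.
move: js; rewrite size_map size_iota => js.
rewrite !(nth_map 0) ?size_iota ?(ltn_trans ij) // !nth_iota ?(ltn_trans ij) //.
rewrite !add0n -{1}(subnKC (ltnW ij)) expgnDr -{1}[(x ^+ i)%g]mulg1.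
by move=> /mulgI xij; exists (j - i)%N; rewrite ?subn_gt0.
Qed.

Lemma generates_uniq (G : groupType) (g : G) (H1 H2 : {fset G}) :
  generates g H1 -> generates g H2 -> H1 = H2.
Proof.
by move=> g1 g2; apply/fsetP => h; apply/idP/idP => [/g1/g2|/g2/g1].
Qed.

Lemma generates_mem (G : groupType) (g : G) (H : {fset G}) :
  generates g H -> g \in H.
Proof. by move=> gH; apply/gH; exists 1%N; left. Qed.

Lemma generates_exp (G : groupType) (x y : G) i j (H : {fset G}) :
  (y = x ^+ i)%g -> (x = y ^+ j)%g -> generates x H -> generates y H.
Proof.
move=> yx xy xH h; rewrite xH; split=> -[n hn].
  by exists (j * n)%N; rewrite expgnA -xy.
by exists (i * n)%N; rewrite expgnA -yx.
Qed.

Lemma finite_subgroup_generates (G : groupType) (H : {fset G}) (x : G) :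
    finite_subgroup H -> x \in H ->
  exists2 H' : {fset G}, (H' `<=` H)%fset & generates x H'.
Proof.
move=> hH xH; have xnH := finite_subgroup_exp hH xH.
pose P h := `[< exists n : nat, (h = x ^+ n \/ h = x ^- n)%g >].
exists [fset h in H | P h]%fset; first exact: fset_sub.
move=> h; rewrite !inE /=; split=> [/andP[_ /asboolP] //|hP].
apply/andP; split; last exact/asboolP.
by case: hP => n [->|->]; rewrite ?xnH //; apply: (group_closedV hH).
Qed.

Lemma torsion_conjugate (k L : fieldType) (iota : {rmorphism k -> L})
    (N : nat) (x y : torus N L) :
  torsion x -> galois_conjugate iota x y -> torsion y.
Proof.
case=> n n_gt0 xn /galois_conjugateP[s _ ->]; exists n => //.
apply: torus_eqP => i.
by rewrite torus_expE torus_mapE -rmorphXn -torus_expE xn !ffunE /= rmorph1.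
Qed.

(** Conjugate torsion points are powers of each other. *)
Lemma generates_conjugate (k L : fieldType) (iota : {rmorphism k -> L})
    (N : nat) (x y : torus N L) (H : {fset torus N L}) :
    is_separable_closure iota -> torsion x -> galois_conjugate iota x y ->
  generates x H -> generates y H.
Proof.
move=> hL tx xy; have ty := torsion_conjugate tx xy.
have [i yx] := torsion_conjugate_exp hL tx xy.
have [j xy'] := torsion_conjugate_exp hL ty (galois_conjugate_sym xy).
exact: generates_exp yx xy'.
Qed.

Lemma big_seq_unique (R : Type) (idx : R) (op : Monoid.com_law idx)
    (I : eqType) (s : seq I) (P : pred I) (a : I) (E : I -> R) :
    uniq s -> a \in s -> P a -> (forall b, b \in s -> P b -> b = a) ->
  \big[op/idx]_(b <- s | P b) E b = E a.
Proof.
move=> s_uniq sa Pa uniq_a; rewrite big_mkcond (bigD1_seq a) //= Pa.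
rewrite big1_seq ?Monoid.mulm1 // => b /andP[ba sb].
by case: ifP => // /(uniq_a b sb) ba'; rewrite ba' eqxx in ba.
Qed.

End Generators.

(** * Factorization over cyclic subgroups and Galois orbits *)

Theorem theorem4p4 (F : fieldType) (N : nat) (hN : (0 < N)%N)
    (M : {fset 'rV[int]_N}) (hM : 0 \in M)
    (Kbar : fieldType) (iota : {rmorphism {fraction (coef_ring F M)} -> Kbar})
    (hKbar : is_separable_closure iota) :
  (forall xi : torus N Kbar, torsion xi ->
     irreducible_in_coef_ring iota (C_generic iota xi)) /\
  (forall H : {fset torus N Kbar}, finite_subgroup H ->
   forall reps : {fset torus N Kbar} -> {fset torus N Kbar},
     generator_reps iota H reps ->
     laurent_W (coef_embed iota) (generic_laurent F M) H =
       \prod_(H' <- fpowerset H | `[< cyclic_subgroup H' >])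
         \prod_(xi <- reps H') C_generic iota xi ^+ C_exponent iota xi
     /\
     (forall (H' : {fset torus N Kbar}) (xi : torus N Kbar),
        (H' `<=` H)%fset -> cyclic_subgroup H' -> xi \in reps H' ->
        irreducible_in_coef_ring iota (C_generic iota xi))).
Proof.
split=> [xi|H hH reps hreps]; first exact: C_generic_irreducible.
have torH x : x \in H -> torsion x by apply: finite_subgroup_torsion.
have genH x H' : (H' `<=` H)%fset -> generates x H' -> x \in H.
  by move=> /fsubsetP H'H /generates_mem/H'H.
split; last first.
  move=> H' xi H'H cH' /(hreps H' H'H cH').1 xiH'.
  exact: (C_generic_irreducible hM hKbar (torH _ (genH _ _ H'H xiH'))).
rewrite /laurent_W big_mkcond big_seq.
set ev := laurent_eval _ _.
(* Points of [H] are torsion, so no value vanishes and the condition in [laurent_W] always holds. *)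
transitivity (\prod_(z <- H) ev z).
  rewrite [RHS]big_seq; apply: eq_bigr => z /torH tz.
  by rewrite generic_eval_neq0.
(* Each [z] is attached to the one subgroup it generates, before the products are exchanged. *)
transitivity (\prod_(z <- H) \prod_(H' <- fpowerset H
    | `[< cyclic_subgroup H' >] && `[< generates z H' >]) ev z).
  rewrite big_seq [RHS]big_seq; apply: eq_bigr => z zH.
  have [H' H'H zH'] := finite_subgroup_generates hH zH.
  rewrite (big_seq_unique _ (a := H')) ?fset_uniq ?fpowersetE //.
    by apply/andP; split; apply/asboolP => //; exists z.
  by move=> H'' _ /andP[_ /asboolP zH'']; apply: generates_uniq zH'' zH'.
rewrite (exchange_big_dep (fun H' => `[< cyclic_subgroup H' >])) /=; last first.
  by move=> z H' _ /andP[].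
rewrite big_seq_cond [RHS]big_seq_cond; apply: eq_bigr => H'.
rewrite fpowersetE => /andP[H'H /[dup] cH' /asboolP cH'P].
have [repsG repsU] := hreps H' H'H cH'P.
transitivity (\prod_(xi <- reps H')
    \prod_(z <- H | `[< galois_conjugate iota xi z >]) ev z); last first.
  rewrite big_seq [RHS]big_seq; apply: eq_bigr => xi /repsG xiH'.
  have txi : torsion xi := torH _ (genH _ _ H'H xiH').
  (* Conjugates of [xi] generate the same [H'], so the full orbit lies in [H]. *)
  rewrite -(orbit_product hM hKbar txi (S := [fset z in H
    | `[< galois_conjugate iota xi z >]]%fset)) ?big_fset // => z.
  rewrite !inE; split=> [/andP[_ /asboolP] //|xiz].
  apply/andP; split; last exact/asboolP.
  exact: genH H'H (generates_conjugate hKbar txi xiz xiH').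
rewrite (exchange_big_dep xpredT) //= big_mkcond big_seq [RHS]big_seq.
(* A generator of [H'] is conjugate to exactly one representative, any other point to none. *)
apply: eq_bigr => z zH; rewrite cH' /=; case: asboolP => [zH'|nzH'].
  have [xi [[xir zxi] xiU]] := repsU z zH'.
  rewrite (big_seq_unique _ (a := xi)) ?fset_uniq //.
    exact/asboolP/galois_conjugate_sym.
  move=> x xr /asboolP/galois_conjugate_sym zx.
  by apply/esym/xiU.
rewrite big_seq_cond big1 // => xi /andP[/repsG xiH' /asboolP xiz].
case: nzH'.
exact: generates_conjugate hKbar (torH _ (genH _ _ H'H xiH')) xiz xiH'.
Qed.
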